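(* For all $0<\lambda<e^{-(\log L+L)}$ the following holds. The Julia set $\mathcal{J}(\mathcal{Z}_\lambda)$ of the Zorich map $\mathcal{Z}_\lambda$ consists of uncountably many disjoint hairs. Each of the hairs tends to $\infty$ by having its third coordinate go to $\infty$ while the other two coordinates remain bounded. Moreover, for each point $x\notin\mathcal{J}(\mathcal{Z}_\lambda)$, the sequence $\mathcal{Z}_\lambda^n(x)$ converges to a fixed point.
   Context: Zorich maps. Let $Q=\{(x_1,x_2)\in\mathbb{R}^2:|x_1|\le 1,|x_2|\le 1\}$ and let $h=(h_1,h_2,h_3)$ be a sense-preserving $L$-bi-Lipschitz map (i.e. $L^{-1}|u-v|\le|h(u)-h(v)|\le L|u-v|$) from $Q$ onto the upper hemisphere $\{x\in\mathbb{R}^3:|x|=1,\ x_3\ge 0\}$. Define $\mathcal{Z}(x_1,x_2,x_3)=e^{x_3}h(x_1,x_2)$ on $Q\times\mathbb{R}$ and extend $\mathcal{Z}$ to $\mathbb{R}^3$ by repeatedly reflecting across the sides of the square beam in the domain and across the plane $x_3=0$ in the range. Explicitly, if $|x_1-2n|\le1$, $|x_2-2m|\le 1$ with $n,m\in\mathbb{Z}$, and $u=((-1)^n(x_1-2n),(-1)^m(x_2-2m))\in Q$, then $\mathcal{Z}(x)=e^{x_3}(h_1(u),h_2(u),(-1)^{n+m}h_3(u))$. For $\lambda>0$ put $\mathcal{Z}_\lambda=\lambda\mathcal{Z}$; it is a quasiregular map of transcendental type. Julia set. For such a map $f:\mathbb{R}^d\to\mathbb{R}^d$, $\mathcal{J}(f)$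 is the set of all $x\in\mathbb{R}^d$ such that $\operatorname{cap}\left(\mathbb{R}^d\setminus\bigcup_{k=1}^\infty f^k(U)\right)=0$ for every neighbourhood $U$ of $x$, where $\operatorname{cap}$ is conformal capacity: a compact set $F$ has capacity zero if $\inf\int|\nabla u|^d=0$, the infimum being over $u\in C_0^\infty(A)$ with $u\ge 1$ on $F$, for some (equivalently every) bounded open $A\supset F$; a closed set has capacity zero if all of its compact subsets do. A subset $H\subset\mathbb{R}^3$ is a hair if there is a homeomorphism $\gamma:[0,\infty)\to H$ with $\gamma(t)\to\infty$ as $t\to\infty$. *)

(* Defs.v *)
From HB Require Import structures.
From mathcomp Require Import all_boot all_order all_algebra.
From mathcomp Require Import all_classical all_reals all_analysis.

Set Implicit Arguments.
Unset Strict Implicit.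
Unset Printing Implicit Defensive.

Import Order.TTheory GRing.Theory Num.Theory.
Import numFieldNormedType.Exports.

Local Open Scope classical_set_scope.
Local Open Scope ring_scope.

(* The library norm on 'rV[R]_n is the sup norm; its topology is the usual
   one, but metric statements need the Euclidean norm. *)
Definition enorm (R : realType) (n : nat) (v : 'rV[R]_n) : R :=
  Num.sqrt (\sum_(i < n) v 0 i ^+ 2).

Definition point2 (R : realType) (a b : R) : 'rV[R]_2 :=
  \row_(j < 2) [:: a; b]`_j.

Definition point3 (R : realType) (a b c : R) : 'rV[R]_3 :=
  \row_(j < 3) [:: a; b; c]`_j.

Definition square (R : realType) : set 'rV[R]_2 :=
  [set u | `|u 0 0| <= 1 /\ `|u 0 1| <= 1].

Definition upper_hemisphere (R : realType) : set 'rV[R]_3 :=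
  [set x | enorm x = 1 /\ 0 <= x 0 2].

Definition bilipschitz_on (R : realType) (m n : nat) (D : set 'rV[R]_m)
    (L : R) (h : 'rV[R]_m -> 'rV[R]_n) : Prop :=
  0 < L /\
  forall u v, D u -> D v ->
    L^-1 * enorm (u - v) <= enorm (h u - h v) <= L * enorm (u - v).

(* The hemisphere is oriented by its outward normal, so that the vertical
   projection (x1, x2, x3) |-> (x1, x2) is a sense-preserving homeomorphism
   onto the closed unit disc. Accordingly an injective h is sense-preserving
   when (h1, h2) has local degree +1: the image of every positively oriented
   circle in the square winds once, counterclockwise, around the image of the
   centre. Here (rho, theta) are polar coordinates of the image circle relative
   to the image of the centre, theta being a continuous argument. *)
Definition sense_preserving (R : realType) (h : 'rV[R]_2 -> 'rV[R]_3) : Prop :=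
  forall (p : 'rV[R]_2) (r : R), 0 < r ->
    [set u | enorm (u - p) <= r] `<=` @square R ->
    exists rho theta : R -> R,
      [/\ {within `[0, 2 * pi], continuous theta},
          theta (2 * pi) = theta 0 + 2 * pi &
          forall t, 0 <= t <= 2 * pi ->
            let w := h (p + point2 (r * cos t) (r * sin t)) - h p in
            [/\ 0 < rho t, w 0 0 = rho t * cos (theta t)
                         & w 0 1 = rho t * sin (theta t)]].

(* A point x with x1 or x2 an odd integer has several admissible (n, m); that
   the formula holds for all of them amounts to h mapping the boundary of the
   square to the equator, which every homeomorphism of the square onto the
   hemisphere does. *)
Definition zorich_map (R : realType) (h : 'rV[R]_2 -> 'rV[R]_3)
    (Z : 'rV[R]_3 -> 'rV[R]_3) : Prop :=
  forall (x : 'rV[R]_3) (n m : int),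
    `|x 0 0 - 2 * n%:~R| <= 1 -> `|x 0 1 - 2 * m%:~R| <= 1 ->
    let u := point2 ((-1) ^ n * (x 0 0 - 2 * n%:~R))
                    ((-1) ^ m * (x 0 1 - 2 * m%:~R)) in
    Z x = expR (x 0 2) *:
      point3 (h u 0 0) (h u 0 1) ((-1) ^ (n + m) * h u 0 2).

Definition partial (R : realType) (u : 'rV[R]_3 -> R) (i : 'I_3) :
    'rV[R]_3 -> R :=
  fun x => 'D_(delta_mx 0 i) u x.

Definition iter_partial (R : realType) (u : 'rV[R]_3 -> R) (s : seq 'I_3) :
    'rV[R]_3 -> R :=
  foldl (@partial R) u s.

Definition smooth (R : realType) (u : 'rV[R]_3 -> R) : Prop :=
  forall s : seq 'I_3,
    continuous (iter_partial u s) /\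
    forall (i : 'I_3) x, derivable (iter_partial u s) x (delta_mx 0 i).

Definition grad (R : realType) (u : 'rV[R]_3 -> R) (x : 'rV[R]_3) :
    'rV[R]_3 :=
  \row_i partial u i x.

Definition test_function (R : realType) (A : set 'rV[R]_3)
    (u : 'rV[R]_3 -> R) : Prop :=
  let supp := closure [set x | u x != 0] in
  [/\ smooth u, compact supp & supp `<=` A].

(* Integration over R^3 is carried out on R * R * R with the product of the
   Lebesgue measures. *)
Definition energy (R : realType) (u : 'rV[R]_3 -> R) : \bar R :=
  \int[(@lebesgue_measure R \x @lebesgue_measure R) \x @lebesgue_measure R]_p
    (enorm (grad u (point3 p.1.1 p.1.2 p.2)) ^+ 3)%:E.

Definition condenser_capacity (R : realType) (A F : set 'rV[R]_3) : \bar R :=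
  ereal_inf [set energy u |
    u in [set u | test_function A u /\ forall x, F x -> 1 <= u x]].

Definition compact_capacity_zero (R : realType) (F : set 'rV[R]_3) : Prop :=
  exists A : set 'rV[R]_3,
    [/\ open A, bounded_set A, F `<=` A & condenser_capacity A F = 0%E].

Definition capacity_zero (R : realType) (E : set 'rV[R]_3) : Prop :=
  forall F : set 'rV[R]_3, compact F -> F `<=` E -> compact_capacity_zero F.

Definition julia (R : realType) (f : 'rV[R]_3 -> 'rV[R]_3) : set 'rV[R]_3 :=
  [set x | forall U : set 'rV[R]_3, nbhs x U ->
    capacity_zero (~` \bigcup_(k in [set k | (1 <= k)%N]) (iter k f @` U))].

(* gamma, restricted to [0, +oo[, is a homeomorphism onto H (with inverse
   delta) and tends to infinity. *)
Definition hair_parametrization (R : realType) (H : set 'rV[R]_3)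
    (gamma : R -> 'rV[R]_3) : Prop :=
  [/\ {within `[0, +oo[, continuous gamma},
      gamma @` `[0, +oo[ = H,
      exists delta : 'rV[R]_3 -> R,
        {within H, continuous delta} /\
        forall t, 0 <= t -> delta (gamma t) = t &
      enorm (gamma t) @[t --> +oo] --> +oo].

Definition hair (R : realType) (H : set 'rV[R]_3) : Prop :=
  exists gamma : R -> 'rV[R]_3, hair_parametrization H gamma.

(* Main.v *)
Require Import Defs.
From HB Require Import structures.
From mathcomp Require Import all_boot all_order all_algebra.
From mathcomp Require Import all_classical all_reals all_analysis.
From mathcomp Require Import measurable_realfun.
From mathcomp Require Import ring lra zify.

Import Order.TTheory GRing.Theory Num.Theory.
Import numFieldNormedType.Exports.

Local Open Scope classical_set_scope.
Local Open Scope ring_scope.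

Set Implicit Arguments.
Unset Strict Implicit.
Unset Printing Implicit Defensive.

(** Write f for the map lambda Z, rad t = lambda e ^ t for the radius of the sphere
    into which f sends the plane x3 = t, and height for the number with
    rad height = L. The bound on lambda gives rad L < 1 / L and height > L, and
    these two inequalities govern the dynamics.

    Below. A point with x3 <= L is mapped into the ball of radius 1 / L. This ball
    lies in the central beam, f maps it into itself and contracts it by the factor
    L * rad L < 1. So an orbit that does not stay above L converges to a fixed
    point ([not_high_converges]).

    Above. Where f takes values above height, it expands distances on each beam by
    height / L > 1 ([map_expanding]). Hence its inverse branches contract, and the
    points whose orbits stay above L forever form an expanding set, called [high].

    The Julia set is [high] ([juliaE]). A point outside has a neighbourhood all of
    whose iterates stay below some height, and so miss a horizontal square; such a
    square has positive capacity, because a test function that is 1 on the square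
    and 0 far above it pays at least a fixed energy on each vertical line
    ([flat_square_capacity]). The iterates of a neighbourhood of a point of [high]
    cover everything except the origin ([high_blowup]), and a point has zero
    capacity, as the average of bumps at n successive dyadic scales shows
    ([compact_capacity_zero_point]).

    Hairs. A point of [high] is never on the side of a beam, so its orbit has a
    unique itinerary s, and [high] is the disjoint union of the sets [hair_of s].
    Two points with the same itinerary are at bounded horizontal distance at all
    times but are driven apart by the expansion, so one orbit gets higher than the
    other; once it is 4 higher, it remains so forever and escapes faster
    ([gap_persists]). Thus each hair is ordered by the speed of escape, measured by
    the limit of rad ^ -k applied to the third coordinate of f ^ k (x). Speed is
    injective on a hair, with continuous inverse. Every speed larger than an
    occurring one occurs, because the orbit to be found can be sketched over the
    centres of the beams and then shadowed ([shadow], [speed_onto]); and the least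
    speed is attained, by compactness ([speed_min]). So speed identifies the hair
    with a closed half-line. A hair lies in one beam and can only escape upwards.

    Shadowing also yields a point for every itinerary with values in the two beams
    (0, 0) and (1, 1), both of which are mapped onto the upper side of y3 = 0, and
    there are uncountably many of these itineraries. *)

(** * Euclidean geometry and convergence in dimension three *)

Section EuclideanSpace.
Variable R : realType.
Implicit Types (x y z : 'rV[R]_3).

Lemma ord3P (i : 'I_3) : [\/ i = 0, i = 1 | i = 2].
Proof.
by case: i => -[|[|[|//]]] ilt; [constructor 1|constructor 2|constructor 3]; exact: val_inj.
Qed.

Lemma point3E0 (a b c : R) : point3 a b c 0 0 = a. Proof. by rewrite mxE. Qed.
Lemma point3E1 (a b c : R) : point3 a b c 0 1 = b. Proof. by rewrite mxE. Qed.
Lemma point3E2 (a b c : R) : point3 a b c 0 2 = c. Proof. by rewrite mxE. Qed.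
Definition point3E := (point3E0, point3E1, point3E2).

Lemma point2E0 (a b : R) : point2 a b 0 0 = a. Proof. by rewrite mxE. Qed.
Lemma point2E1 (a b : R) : point2 a b 0 1 = b. Proof. by rewrite mxE. Qed.
Definition point2E := (point2E0, point2E1).

Lemma row3P x y : x 0 0 = y 0 0 -> x 0 1 = y 0 1 -> x 0 2 = y 0 2 -> x = y.
Proof. by move=> e0 e1 e2; apply/rowP => i; case: (ord3P i) => ->. Qed.

Lemma row2P (u v : 'rV[R]_2) : u 0 0 = v 0 0 -> u 0 1 = v 0 1 -> u = v.
Proof.
move=> e0 e1; apply/rowP => -[[|[|//]] ilt].
  by rewrite (_ : Ordinal _ = 0)//; exact: val_inj.
by rewrite (_ : Ordinal _ = 1)//; exact: val_inj.
Qed.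

Lemma point3_eta x : point3 (x 0 0) (x 0 1) (x 0 2) = x.
Proof. by apply: row3P; rewrite point3E. Qed.

Lemma enorm_ge0 n (v : 'rV[R]_n) : 0 <= enorm v.
Proof. exact: sqrtr_ge0. Qed.

Lemma enorm3_sq x : enorm x ^+ 2 = x 0 0 ^+ 2 + x 0 1 ^+ 2 + x 0 2 ^+ 2.
Proof.
rewrite /enorm sqr_sqrtr; last by apply: sumr_ge0 => i _; exact: sqr_ge0.
rewrite !big_ord_recl big_ord0 addr0 addrA.
by congr (x 0 _ ^+ 2 + x 0 _ ^+ 2 + x 0 _ ^+ 2); exact: val_inj.
Qed.

Lemma enorm2_sq (u : 'rV[R]_2) : enorm u ^+ 2 = u 0 0 ^+ 2 + u 0 1 ^+ 2.
Proof.
rewrite /enorm sqr_sqrtr; last by apply: sumr_ge0 => i _; exact: sqr_ge0.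
rewrite !big_ord_recl big_ord0 addr0.
by congr (u 0 _ ^+ 2 + u 0 _ ^+ 2); exact: val_inj.
Qed.

Lemma coord_le_enorm x i : `|x 0 i| <= enorm x.
Proof.
rewrite -(@ler_pXn2r _ 2)// ?nnegrE ?enorm_ge0// real_normK ?num_real// enorm3_sq.
have := sqr_ge0 (x 0 0); have := sqr_ge0 (x 0 1); have := sqr_ge0 (x 0 2).
by case: (ord3P i) => ->; lra.
Qed.

Lemma le_enorm_sum x : enorm x <= `|x 0 0| + `|x 0 1| + `|x 0 2|.
Proof.
rewrite -(@ler_pXn2r _ 2)// ?nnegrE ?enorm_ge0 ?addr_ge0// enorm3_sq.
rewrite -[x 0 0 ^+ 2]real_normK ?num_real// -[x 0 1 ^+ 2]real_normK ?num_real//.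
rewrite -[x 0 2 ^+ 2]real_normK ?num_real//.
move: (normr_ge0 (x 0 0)) (normr_ge0 (x 0 1)) (normr_ge0 (x 0 2)); nra.
Qed.

Lemma le_of_sqr (a b : R) : 0 <= b -> a ^+ 2 <= b ^+ 2 -> a <= b.
Proof.
move=> b0 ab; have [a0|a0] := lerP 0 a; last by rewrite (le_trans (ltW a0)).
by rewrite -(@ler_pXn2r _ 2).
Qed.

Lemma enormD x y : enorm (x + y) <= enorm x + enorm y.
Proof.
apply: le_of_sqr; first by rewrite addr_ge0 ?enorm_ge0.
have hx := enorm3_sq x; have hy := enorm3_sq y.
have x0 := enorm_ge0 x; have y0 := enorm_ge0 y.
rewrite enorm3_sq !mxE.
(* Cauchy-Schwarz: by Lagrange's identity the defect is a sum of squares. *)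
have CS : x 0 0 * y 0 0 + x 0 1 * y 0 1 + x 0 2 * y 0 2 <= enorm x * enorm y.
  apply: le_of_sqr; first by rewrite mulr_ge0.
  rewrite exprMn hx hy -subr_ge0.
  rewrite (_ : _ - _ = (x 0 0 * y 0 1 - x 0 1 * y 0 0) ^+ 2 +
    (x 0 0 * y 0 2 - x 0 2 * y 0 0) ^+ 2 + (x 0 1 * y 0 2 - x 0 2 * y 0 1) ^+ 2).
    by rewrite !addr_ge0 ?sqr_ge0.
  ring.
rewrite [leRHS]sqrrD hx hy; lra.
Qed.

Lemma enormN x : enorm (- x) = enorm x.
Proof.
by apply/eqP; rewrite -(@eqrXn2 _ 2) ?enorm_ge0// !enorm3_sq !mxE !sqrrN.
Qed.

Lemma enormB x y : enorm (x - y) = enorm (y - x).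
Proof. by rewrite -enormN opprB. Qed.

Lemma enorm_distD z x y : enorm (x - y) <= enorm (x - z) + enorm (z - y).
Proof. by apply: le_trans (enormD _ _); rewrite addrA subrK. Qed.

Lemma enormZ (a : R) x : enorm (a *: x) = `|a| * enorm x.
Proof.
apply/eqP; rewrite -(@eqrXn2 _ 2) ?mulr_ge0 ?enorm_ge0// exprMn !enorm3_sq !mxE.
rewrite real_normK ?num_real//; apply/eqP; ring.
Qed.

Lemma enorm0_eq0 x : enorm x = 0 -> x = 0.
Proof.
move=> x0; apply/rowP => i; apply/eqP; rewrite mxE -normr_le0 -x0.
exact: coord_le_enorm.
Qed.

Lemma ball_coordP x (e : R) y : 0 < e ->
  ball x e y <-> forall i, `|x 0 i - y 0 i| < e.
Proof.
move=> e0; split => [[_ H] i|H]; first exact: (H 0 i).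
by split => // i j; rewrite (ord1 i); exact: H.
Qed.

Lemma near_coord x (e : R) : 0 < e ->
  \forall y \near x, forall i : 'I_3, `|x 0 i - (y : 'rV[R]_3) 0 i| < e.
Proof.
move=> e0; apply/nbhs_ballP; exists e => // y; exact: (ball_coordP x y e0).1.
Qed.

Lemma near_enorm x (e : R) : 0 < e -> \forall y \near x, enorm (x - y) < e.
Proof.
move=> e0; have e30 : 0 < e / 3 by rewrite divr_gt0.
apply: filterS (near_coord x e30) => y H.
apply: le_lt_trans (le_enorm_sum _) _; rewrite !mxE.
have := H 0; have := H 1; have := H 2; lra.
Qed.

(** The topology is that of the sup norm, whereas every estimate below is in the
    Euclidean norm; this lemma and the next one pass from one to the other. *)
Lemma nbhs_enormP x (U : set 'rV[R]_3) :
  nbhs x U <-> exists2 e : R, 0 < e & forall y, enorm (x - y) < e -> U y.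
Proof.
split=> [/nbhs_ballP[e /= e0 eU]|[e e0 eU]]; last first.
  exact: filterS (near_enorm x e0).
exists e => // y xy; apply: eU; apply/(ball_coordP x y e0) => i.
apply: le_lt_trans xy; apply: le_trans (coord_le_enorm _ i).
by rewrite !mxE.
Qed.

Lemma cvg_enormP (T : Type) (F : set_system T) (FF : Filter F) (f : T -> 'rV[R]_3) x :
  f t @[t --> F] --> x <->
  forall e : R, 0 < e -> \forall t \near F, enorm (x - f t) < e.
Proof.
split=> [fx e e0|H]; first exact: (fx _ (near_enorm x e0)).
move=> U /= /nbhs_enormP[e e0 eU]; apply: filterS (H _ e0) => t; exact: eU.
Qed.

Lemma cvg_point3 (T : Type) (F : set_system T) (FF : Filter F) (a b c : T -> R) (la lb lc : R) :
  a t @[t --> F] --> la -> b t @[t --> F] --> lb -> c t @[t --> F] --> lc ->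
  point3 (a t) (b t) (c t) @[t --> F] --> point3 la lb lc.
Proof.
move=> /cvgrPdist_lt Ha /cvgrPdist_lt Hb /cvgrPdist_lt Hc.
apply/cvg_enormP => e e0; have e30 : 0 < e / 3 by rewrite divr_gt0.
have := Ha _ e30; have := Hb _ e30; have := Hc _ e30; clear Ha Hb Hc.
move=> Hc Hb Ha; near=> t.
apply: le_lt_trans (le_enorm_sum _) _; rewrite !(mxE _ _ 0) -/(point3 _ _ _).
rewrite /=.
have : `|la - a t| < e / 3 by near: t.
have : `|lb - b t| < e / 3 by near: t.
have : `|lc - c t| < e / 3 by near: t.
lra.
Unshelve. all: by end_near. Qed.

Lemma norm_le_enorm x : `|x| <= enorm x.
Proof.
rewrite [leLHS]/Num.norm/= mx_normrE; apply/bigmax_leP; split; first exact: enorm_ge0.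
by move=> [i j] _/=; rewrite (ord1 i); exact: coord_le_enorm.
Qed.

Lemma coord_le_norm x i : `|x 0 i| <= `|x|.
Proof.
rewrite [leRHS]/Num.norm/= mx_normrE; apply/bigmax_geP; right; exists (0, i) => //.
Qed.

End EuclideanSpace.

(** * Smooth functions built from exp (- 1 / t) *)

Section FlatFunctions.
Variable R : realType.
Implicit Types (p : {poly R}) (t : R).

(** The function p (1 / t) exp (- 1 / t) on t > 0, extended by 0. Carrying the
    polynomial p along makes the family closed under derivation, hence made of
    smooth functions. *)
Definition flat p t : R := if 0 < t then p.[t^-1] * expR (- t^-1) else 0.

(** For a monomial this is s ^ n / n! <= exp s; the general case follows by
    linearity. *)
Lemma poly_expRN_bounded p :
  exists2 C : R, 0 <= C & forall s : R, 0 <= s -> `|p.[s]| * expR (- s) <= C.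
Proof.
have key n : exists2 C : R, 0 <= C & forall s : R, 0 <= s -> s ^+ n * expR (- s) <= C.
  exists (n`!%:R + 1); first by rewrite addr_ge0.
  move=> s s0; rewrite expRN ler_pdivrMr ?expR_gt0//.
  case: n => [|n].
    rewrite expr0 fact0 (_ : 1%:R = 1)// -[leLHS]mulr1 ler_pM ?lerDl//.
    by rewrite (le_trans _ (expR_ge1Dx s)) // lerDl.
  have := expR_ge1Dxn n s0; set E := expR s; set f := n.+1`!%:R => H.
  have f0 : 0 < f :> R by rewrite ltr0n fact_gt0.
  have : s ^+ n.+1 / f <= E by apply: le_trans H; rewrite lerDr.
  rewrite ler_pdivrMr// => /le_trans; apply.
  by rewrite mulrDl mul1r [leLHS]mulrC lerDl expR_ge0.
elim/poly_ind: p => [|p c [C C0 IH]].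
  by exists 0 => // s _; rewrite horner0 normr0 mul0r.
have [D D0 HD] : exists2 D : R, 0 <= D &
    forall s : R, 0 <= s -> `|(p * 'X).[s]| * expR (- s) <= D.
  rewrite -[p]coefK; elim: (size p) (fun i => p`_i) => [|n IHn] F.
    by exists 0 => // s _; rewrite poly_def big_ord0 mul0r horner0 normr0 mul0r.
  have [D D0 HD] := IHn F; have [E E0 HE] := key n.+1.
  exists (D + `|F n| * E); first by rewrite addr_ge0// mulr_ge0.
  move=> s s0; rewrite poly_def big_ord_recr/= -poly_def mulrDl hornerD.
  apply: le_trans (_ : (`|(\poly_(i < n) F i * 'X).[s]| +
    `|(F n *: 'X^n * 'X).[s]|) * expR (- s) <= _).
    by rewrite ler_wpM2r ?expR_ge0// ler_normD.
  rewrite mulrDl lerD ?HD//.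
  rewrite -scalerAl -exprSr hornerZ hornerXn normrM -mulrA.
  by rewrite [`|s ^+ _|]ger0_norm ?exprn_ge0// ler_wpM2l ?HE// normr_ge0.
exists (D + `|c|); first by rewrite addr_ge0.
move=> s s0; rewrite hornerD hornerC.
apply: le_trans (_ : (`|(p * 'X).[s]| + `|c|) * expR (- s) <= _).
  by rewrite ler_wpM2r ?expR_ge0// ler_normD.
rewrite mulrDl lerD ?HD// -[leRHS]mulr1 ler_wpM2l// expR_le1.
by rewrite oppr_le0.
Qed.

(** A quadratic bound is exactly what differentiability at 0, with derivative 0,
    requires. *)
Lemma flat_sq_bound p : exists2 C : R, 0 <= C & forall t, `|flat p t| <= C * t ^+ 2.
Proof.
have [C C0 HC] := poly_expRN_bounded (p * 'X^2).
exists C => // t; rewrite /flat; case: ifPn => t0; last first.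
  by rewrite normr0 mulr_ge0// sqr_ge0.
have s0 : 0 <= t^-1 by rewrite invr_ge0 ltW.
have := HC _ s0; rewrite hornerM hornerXn normrM [`|p.[_] * expR _|]normrM [`|expR _|]ger0_norm ?expR_ge0//.
rewrite [`|t^-1 ^+ 2|]ger0_norm ?exprn_ge0// => H.
rewrite -ler_pdivrMr ?exprn_gt0// -exprVn.
by apply: le_trans H; rewrite mulrAC.
Qed.

(** For t > 0 the chain rule turns p (1 / t) exp (- 1 / t) into
    t ^- 2 * (p - p') (1 / t) exp (- 1 / t), whose polynomial factor is
    X ^ 2 (p - p'). *)
Lemma is_derive_flat p t :
  is_derive t 1 (flat p) (flat ('X^2 * (p - p^`())) t).
Proof.
have [t0|t0|t0] := ltgtP t 0.
- rewrite {2}/flat ltNge ltW//=.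
  apply: (@near_eq_is_derive _ _ _ (cst 0)).
    by near=> u; rewrite /flat/= ltNge ltW//=; near: u; exact: lt_nbhsl.
- rewrite {2}/flat t0.
  apply: (@near_eq_is_derive R R^o R^o (fun u : R => p.[u^-1] * expR (- u^-1))).
    by near=> u; rewrite /flat/= ifT//; near: u; exact: lt_nbhsr.
  have tN0 : t != 0 by rewrite gt_eqF.
  have dV : is_derive t 1 (fun u : R => u^-1) (- t ^- 2).
    apply: is_derive_eq (is_deriveV _ _) _ => //.
    by rewrite /GRing.scale/= mulr1.
  have dp : is_derive t 1 (fun u : R => p.[u^-1]) (p^`().[t^-1] * (- t ^- 2)).
    apply: is_derive_eq (@is_derive1_comp _ (horner p) GRing.inv t _ _ _ dV) _.
    by [].
  have dN : is_derive t 1 (fun u : R => - u^-1) (t ^- 2).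
    by apply: is_derive_eq (is_deriveN dV) _; rewrite opprK.
  have de : is_derive t 1 (fun u : R => expR (- u^-1)) (expR (- t^-1) * t ^- 2).
    exact: (@is_derive1_comp _ expR (fun u => - u^-1) t _ _ _ dN).
  apply: is_derive_eq (is_deriveM dp de) _.
  rewrite hornerM hornerXn hornerD hornerN exprVn /GRing.scale/=; ring.
- subst t; rewrite {2}/flat ltxx.
  have [C C0 HC] := flat_sq_bound p.
  have H : h^-1 *: (flat p (h *: (1:R) + 0) - flat p 0) @[h --> 0^'] --> (0 : R).
    apply/cvgr0Pnorm_lt => e e0.
    near=> h.
    have hN0 : h != 0 by near: h; exact: nbhs_dnbhs_neq.
    rewrite /GRing.scale/= mulr1 addr0 [flat p 0]/flat ltxx subr0 normrM normfV.
    rewrite mulrC ltr_pdivrMr ?normr_gt0//.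
    apply: le_lt_trans (HC h) _.
    have -> : h ^+ 2 = `|h| * `|h| by rewrite -normrM -expr2 ger0_norm ?sqr_ge0.
    rewrite mulrA ltr_pM2r ?normr_gt0//.
    have : `|h| < e / (C + 1).
      near: h; apply: dnbhs0_lt; by rewrite divr_gt0// ltr_wpDl.
    rewrite ltr_pdivlMr ?ltr_wpDl// => /le_lt_trans; apply.
    by rewrite mulrC ler_wpM2l// lerDl.
  apply: DeriveDef; first by apply/cvg_ex; exists 0.
  exact: cvg_lim H.
Unshelve. all: by end_near. Qed.

End FlatFunctions.

Section SmoothExpressions.
Variable R : realType.
Implicit Types (f g : 'rV[R]_3 -> R) (p : {poly R}).

(** Smoothness speaks of all iterated partial derivatives. On a class of
    functions that are differentiable and closed under partial derivatives, it
    follows by induction on the list of directions; this is such a class, large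
    enough for the cut-off functions below. *)
Inductive smooth_expr : ('rV[R]_3 -> R) -> Prop :=
| SE_const c : smooth_expr (fun _ => c)
| SE_coord i : smooth_expr (fun x => x 0 i)
| SE_add f g : smooth_expr f -> smooth_expr g -> smooth_expr (fun x => f x + g x)
| SE_mul f g : smooth_expr f -> smooth_expr g -> smooth_expr (fun x => f x * g x)
| SE_flat p f : smooth_expr f -> smooth_expr (fun x => flat p (f x)).

Lemma flat_differentiable p (t : R) : differentiable (flat p) t.
Proof. by apply/derivable1_diffP; apply: ex_derive; exact: is_derive_flat. Qed.

Lemma smooth_expr_diff f : smooth_expr f -> forall x, differentiable f x.
Proof.
elim=> {f} [c|i|f g _ df _ dg|f g _ df _ dg|p f _ df] x.
- exact: differentiable_cst.
- exact: differentiable_coord.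
- exact: differentiableD.
- exact: differentiableM.
- apply: (@differentiable_comp _ _ _ _ f (flat p)) => //.
  exact: flat_differentiable.
Qed.

Lemma partial_const i c : partial (fun _ : 'rV[R]_3 => c) i = fun _ => 0.
Proof. by apply/funext => x; rewrite /partial derive_cst. Qed.

Lemma partial_coord i j : partial (fun x : 'rV[R]_3 => x 0 j) i = fun _ => (i == j)%:R.
Proof.
apply/funext => x; rewrite /partial.
rewrite deriveE; last exact: differentiable_coord.
have @f : {linear 'rV[R]_3 -> R}.
  by exists (fun N : 'rV[R]_3 => N 0 j); do 2![eexists]; do ?[constructor];
     rewrite ?mxE// => ? *; rewrite ?mxE//; move=> ?; rewrite !mxE.
rewrite (_ : (fun _ => _) = f)// diff_lin; last exact: coord_continuous.
by rewrite /= mxE eqxx/= eq_sym.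
Qed.

Lemma partial_add f g i : (forall x, differentiable f x) ->
  (forall x, differentiable g x) ->
  partial (fun x => f x + g x) i = fun x => partial f i x + partial g i x.
Proof.
move=> df dg; apply/funext => x; rewrite /partial.
by rewrite (@deriveD _ _ _ f g)//; exact: diff_derivable.
Qed.

Lemma partial_mul f g i : (forall x, differentiable f x) ->
  (forall x, differentiable g x) ->
  partial (fun x => f x * g x) i =
    fun x => f x * partial g i x + g x * partial f i x.
Proof.
move=> df dg; apply/funext => x; rewrite /partial.
by rewrite (@deriveM _ _ f g)//; exact: diff_derivable.
Qed.

Lemma partial_flat p f i : (forall x, differentiable f x) ->
  partial (fun x => flat p (f x)) i =
    fun x => partial f i x * flat ('X^2 * (p - p^`())) (f x).
Proof.
move=> df; apply/funext => x; rewrite /partial.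
have dp := flat_differentiable p (f x).
rewrite deriveE; last exact: (@differentiable_comp _ _ _ _ f (flat p)).
rewrite (@diff_comp _ _ _ _ f (flat p))//= (diff1E dp) derive1E deriveE//.
have [_ <-] := is_derive_flat p (f x).
by rewrite [in RHS]deriveE// [in RHS]deriveE.
Qed.

Lemma smooth_expr_partial f i : smooth_expr f -> smooth_expr (partial f i).
Proof.
elim=> {f} [c|j|f g sf IHf sg IHg|f g sf IHf sg IHg|p f sf IHf].
- by rewrite partial_const; constructor.
- by rewrite partial_coord; constructor.
- by rewrite partial_add; [constructor|exact: smooth_expr_diff..].
- by rewrite partial_mul; [do 2 constructor|exact: smooth_expr_diff..].
- by rewrite partial_flat; [do ?constructor|exact: smooth_expr_diff].
Qed.

Lemma smooth_expr_smooth f : smooth_expr f -> smooth f.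
Proof.
move=> sf s; have : smooth_expr (iter_partial f s).
  elim: s f sf => //= i s IHs f sf; apply: IHs; exact: smooth_expr_partial.
move: (iter_partial f s) => g /smooth_expr_diff dg; split.
  by move=> x; exact: differentiable_continuous.
by move=> i x; exact: diff_derivable.
Qed.

Lemma smooth_expr_sum (F : nat -> 'rV[R]_3 -> R) n :
  (forall j, smooth_expr (F j)) -> smooth_expr (fun x => \sum_(j < n) F j x).
Proof.
move=> sF; elim: n => [|n IHn].
  by under eq_fun do rewrite big_ord0; constructor.
by under eq_fun do rewrite big_ord_recr/=; constructor.
Qed.

Lemma partial_sum (F : nat -> 'rV[R]_3 -> R) n i :
  (forall j, smooth_expr (F j)) ->
  partial (fun x => \sum_(j < n) F j x) i = fun x => \sum_(j < n) partial (F j) i x.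
Proof.
move=> sF; elim: n => [|n IHn].
  under eq_fun do rewrite big_ord0; rewrite partial_const.
  by apply/funext => x; rewrite big_ord0.
under eq_fun do rewrite big_ord_recr/=.
rewrite partial_add; last exact: smooth_expr_diff.
  by rewrite IHn; apply/funext => x; rewrite big_ord_recr.
by apply: smooth_expr_diff; exact: smooth_expr_sum.
Qed.

(** This function is the derivative of [flat 1], so [flat 1] is 2-Lipschitz. The
    bound is s ^ 2 / 2 <= exp s at s = 1 / t. *)
Lemma flatX2_bound (t : R) : 0 <= flat ('X^2 * (1 - 1^`())) t <= 2.
Proof.
rewrite derivC subr0 mulr1 /flat; case: ifPn => [t0|]; last by rewrite lexx ler0n.
rewrite hornerXn; set s := t^-1; have s0 : 0 <= s by rewrite /s invr_ge0 ltW.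
rewrite mulr_ge0 ?expR_ge0 ?sqr_ge0//= expRN ler_pdivrMr ?expR_gt0//.
have := expR_ge1Dxn 1 s0; rewrite (_ : 2`! = 2)%N//.
set E := expR s; set q := s ^+ 2; lra.
Qed.

Definition sqnorm (x : 'rV[R]_3) : R := x 0 0 ^+ 2 + x 0 1 ^+ 2 + x 0 2 ^+ 2.

(** A bump with value 1 at the origin that vanishes outside the ball of radius
    2 ^- j. Its argument 1 - 4 ^ j |x| ^ 2 is spelled with sums and products so
    that it is a [smooth_expr] as it stands. *)
Definition spike (j : nat) (x : 'rV[R]_3) : R :=
  expR 1 * flat 1 (1 + (- 4 ^+ j) * (x 0 0 * x 0 0 + x 0 1 * x 0 1 + x 0 2 * x 0 2)).

Lemma spike_smooth j : smooth_expr (spike j).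
Proof. by rewrite /spike; repeat constructor. Qed.

Lemma spikeE j x : spike j x = expR 1 * flat 1 (1 - 4 ^+ j * sqnorm x).
Proof. by rewrite /spike /sqnorm !expr2 mulNr. Qed.

Lemma partial_spike j i x : partial (spike j) i x =
  expR 1 * (- (4 ^+ j * 2 * x 0 i)) * flat ('X^2 * (1 - 1^`())) (1 - 4 ^+ j * sqnorm x).
Proof.
have D (f : 'rV[R]_3 -> R) : smooth_expr f -> forall x, differentiable f x by exact: smooth_expr_diff.
rewrite /spike partial_mul; try (by apply: D; repeat constructor).
rewrite partial_const mulr0 addr0 -mulrA; congr (_ * _).
rewrite partial_flat; try (by apply: D; repeat constructor).
rewrite /sqnorm !expr2 mulNr; congr (_ * _).
rewrite partial_add; try (by apply: D; repeat constructor).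
rewrite partial_const add0r.
rewrite partial_mul; try (by apply: D; repeat constructor).
rewrite partial_const mulr0 addr0.
do 2 (rewrite partial_add; try (by apply: D; repeat constructor)).
do 3 (rewrite partial_mul; try (by apply: D; repeat constructor)).
rewrite !partial_coord.
case: i => -[|[|[|//]]] ilt; rewrite -!val_eqE/= ?(mulr1,mulr0,addr0,add0r);
 rewrite -mulrA mulNr; congr (- (_ * _)); rewrite mulr2n mulrDl mul1r;
  congr (_ + _); congr (x 0 _); exact: val_inj.
Qed.

End SmoothExpressions.

(** * Measurability of the energy density *)

Section Measurability.
Variable R : realType.

(** Replacing the second variable by the largest multiple of 1 / (n + 1) below it
    gives a function that is measurable on each of countably many horizontal
    strips; by continuity these functions converge pointwise to F. *)
Lemma measurable_caratheodory d (T : measurableType d) (F : T -> R -> R) :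
  (forall s, measurable_fun setT (F^~ s)) -> (forall t, continuous (F t)) ->
  measurable_fun setT (fun p : T * R => F p.1 p.2).
Proof.
move=> mF cF.
pose q n (k : int) : R := k%:~R / n.+1%:R.
pose h n (p : T * R) := F p.1 (q n (Num.floor (n.+1%:R * p.2))).
apply: (@measurable_fun_cvg _ _ _ setT h) => [n|[t s] _].
  move=> _ Y mY; rewrite setTI.
  rewrite (_ : _ @^-1` _ = \bigcup_(k : int)
      ([set t | Y (F t (q n k))] `*` `[q n k, q n (k + 1)[%classic)).
    apply: countable_bigcupT_measurable => [|k].
      exact: countableP.
    apply: measurableX; last exact: measurable_itv.
    by have := mF (q n k) measurableT Y mY; rewrite setTI.
  have n0 : 0 < n.+1%:R :> R by rewrite ltr0n.
  have flE (k : int) (s : R) : (s \in `[q n k, q n (k + 1)[) = (Num.floor (n.+1%:R * s) == k).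
    by rewrite floor_eq in_itv/= ler_pdivrMr// ltr_pdivlMr// mulrC.
  apply/seteqP; split => [[t s]/= H|[t s]/= [k _ [/= H]]].
    by exists (Num.floor (n.+1%:R * s)) => //; split => //=; rewrite flE.
  by rewrite flE => /eqP e; rewrite /h/= e.
rewrite /h/=; suff H : q n (Num.floor (n.+1%:R * s)) @[n --> \oo] --> s by exact: (cvg_comp _ _ H (cF t s)).
apply/cvgrPdist_lt => e e0.
near=> n.
have n0 : 0 < n.+1%:R :> R by rewrite ltr0n.
have /andP[f1 f2] := floor_itv (n.+1%:R * s).
have : n.+1%:R^-1 < e by near: n; exact: (near_infty_natSinv_lt (PosNum e0)).
apply: le_lt_trans; rewrite /q.
move: f1 f2; rewrite intrD; set k := _%:~R => f1 f2.
have k1 : k / n.+1%:R <= s by rewrite ler_pdivrMr// mulrC.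
rewrite ger0_norm ?subr_ge0// -(ler_pM2l n0) mulrBr mulrCA !divff ?gt_eqF// mulr1.
by rewrite lerBlDr addrC ltW.
Unshelve. all: by end_near. Qed.

(** Continuity is for the topology of row vectors, measurability for the product
    sigma-algebra; the three coordinates are treated one at a time. *)
Lemma measurable_point3 (g : 'rV[R]_3 -> R) : continuous g ->
  measurable_fun setT (fun p : R * R * R => g (point3 p.1.1 p.1.2 p.2)).
Proof.
move=> cg.
apply: (@measurable_caratheodory _ (R * R)%type (fun t s => g (point3 t.1 t.2 s))) => [z|[x y]/=].
  apply: (@measurable_caratheodory _ R (fun x y => g (point3 x y z))) => [y|x].
    apply: continuous_measurable_fun => x.
    suff H : point3 x' y z @[x' --> x] --> point3 x y z by exact: (cvg_comp _ _ H (cg _)).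
    by apply: cvg_point3; [exact: cvg_id|exact: cvg_cst..].
  move=> y; suff H : point3 x y' z @[y' --> y] --> point3 x y z by exact: (cvg_comp _ _ H (cg _)).
  by apply: cvg_point3; [exact: cvg_cst|exact: cvg_id|exact: cvg_cst].
move=> z; suff H : point3 x y z' @[z' --> z] --> point3 x y z by exact: (cvg_comp _ _ H (cg _)).
by apply: cvg_point3; [exact: cvg_cst..|exact: cvg_id].
Qed.

Lemma enorm_continuous : continuous (@enorm R 3).
Proof.
move=> x; have FF : Filter (nbhs x) by exact: nbhs_filter.
apply/cvgrPdist_lt => e e0; apply: filterS (near_enorm x e0) => y.
apply: le_lt_trans; rewrite ler_norml; apply/andP; split.
  have := enorm_distD x y 0; rewrite !subr0 enormB; lra.
have := enorm_distD y x 0; rewrite !subr0; lra.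
Qed.

Lemma grad_continuous (u : 'rV[R]_3 -> R) : smooth u -> continuous (grad u).
Proof.
move=> su x; have H i : partial u i y @[y --> x] --> partial u i x by exact: (su [:: i]).1.
rewrite (_ : grad u = fun y => point3 (partial u 0 y) (partial u 1 y) (partial u 2 y)).
  have FF : Filter (nbhs x) by exact: nbhs_filter.
  by rewrite /continuous_at; apply: cvg_point3.
by apply/funext => y; apply: row3P; rewrite point3E mxE.
Qed.

Lemma energy_density_continuous (u : 'rV[R]_3 -> R) : smooth u ->
  continuous (fun x => enorm (grad u x) ^+ 3).
Proof.
move=> su x.
apply: (@continuous_comp _ _ _ (fun x => enorm (grad u x)) (fun s : R => s ^+ 3)).
  apply: (@continuous_comp _ _ _ (grad u) (@enorm R 3)).
    exact: grad_continuous.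
  exact: enorm_continuous.
exact: exprn_continuous.
Qed.

End Measurability.

(** * A flat square has positive capacity *)

Section CapacityOfSquare.
Variable R : realType.
Local Notation mu := (@lebesgue_measure R).

Lemma is_derive_vertical (u : 'rV[R]_3 -> R) x y z :
  derivable u (point3 x y z) (delta_mx 0 2) ->
  is_derive z 1 (fun s => u (point3 x y s)) (partial u 2 (point3 x y z)).
Proof.
move=> du.
have E : (fun h => h^-1 *: (u (point3 x y (h *: (1:R) + z)) - u (point3 x y z))) =
    (fun h => h^-1 *: (u (h *: delta_mx 0 2 + point3 x y z) - u (point3 x y z))).
  apply/funext => h; congr (_ *: (u _ - _)).
  by apply: row3P; rewrite !mxE/= ?(mulr0,mulr1,add0r)// /GRing.scale/= mulr1.
by apply: DeriveDef; rewrite /derivable /derive /partial/= E.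
Qed.

(** A function that falls from 1 to 0 along a segment of length M has energy at
    least that of the linear function of slope 1 / M, namely M * M ^- 3. This is
    Jensen's inequality for t ^ 3: the cube is bounded below by its tangent line
    at c = 1 / M, and the linear term is integrated by the fundamental theorem of
    calculus. *)
Lemma vertical_energy (u : 'rV[R]_3 -> R) x y T M : smooth u -> 0 < M ->
  1 <= u (point3 x y T) -> u (point3 x y (T + M)) = 0 ->
  ((M ^- 2)%:E <= \int[mu]_(s in `[T, (T + M)%R]) (enorm (grad u (point3 x y s)) ^+ 3)%:E)%E.
Proof.
move=> su M0 u1 u0.
pose du s := partial u 2 (point3 x y s).
pose G s := enorm (grad u (point3 x y s)) ^+ 3.
have cv s : point3 x y t @[t --> s] --> point3 x y s.
  by apply: cvg_point3; [exact: cvg_cst..|exact: cvg_id].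
have cdu : continuous du.
  by move=> s; exact: (cvg_comp _ _ (cv s) ((su [:: 2]).1 _)).
have cG : continuous G.
  move=> s.
  pose g x := enorm (grad u x) ^+ 3.
  have cg : continuous g by exact: energy_density_continuous.
  exact: (cvg_comp _ g (cv s) (cg _)).
have TM : T < T + M by rewrite ltrDl.
pose c := M^-1.
have c0 : 0 < c by rewrite invr_gt0.
pose w (s : R) := - (3 * c ^+ 2) * du s.
pose W (s : R) := - (3 * c ^+ 2) * u (point3 x y s).
have D (s : R) : is_derive s 1 W (w s).
  have du' := is_derive_vertical ((su [::]).2 2 (point3 x y s)).
  exact: (is_deriveZ (- (3 * c ^+ 2)) du').
have cw : continuous w by move=> s; apply: cvgM; [exact: cvg_cst|exact: cdu].
have FTC : (\int[mu]_(s in `[T, (T + M)%R]) (w s)%:E = (W (T + M))%:E - (W T)%:E)%E.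
  apply: continuous_FTC2 => //.
  - exact: continuous_subspaceT.
  - have cu (s : R) : {for s, continuous W}.
      by apply/differentiable_continuous/derivable1_diffP; apply: ex_derive.
    split.
    + by move=> s _; apply: ex_derive.
    + by apply: cvg_at_right_filter; exact: cu.
    + by apply: cvg_at_left_filter; exact: cu.
  - by move=> s _; rewrite derive1E; have [] := D s.
(* t ^ 3 - 3 c ^ 2 t + 2 c ^ 3 = (t - c) ^ 2 (t + 2 c) >= 0 for t >= 0 *)
have tangent s : w s <= G s + 2 * c ^+ 3.
  have : `|du s| <= enorm (grad u (point3 x y s)).
    by apply: le_trans (coord_le_enorm _ 2); rewrite mxE.
  rewrite /G /w; set g := enorm _ => dg.
  have dug : - du s <= g by rewrite (le_trans _ dg)// -normrN ler_norm.
  have : 0 <= g by apply: enorm_ge0.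
  move=> g0; rewrite mulNr -mulrN.
  apply: le_trans (_ : 3 * c ^+ 2 * g <= _).
    by rewrite ler_wpM2l// mulr_ge0// sqr_ge0.
  rewrite -subr_ge0 (_ : _ - _ = (g - c) ^+ 2 * (g + 2 * c)); last by ring.
  by rewrite mulr_ge0 ?sqr_ge0// addr_ge0// mulr_ge0// ltW.
have cpt : compact `[T, T + M]%classic by exact: segment_compact.
have I1 : mu.-integrable `[T, (T + M)%R] (EFin \o w).
  by apply: continuous_compact_integrable => //; exact: continuous_subspaceT.
have IG : mu.-integrable `[T, (T + M)%R] (EFin \o G).
  by apply: continuous_compact_integrable => //; exact: continuous_subspaceT.
have Ic (k : R) : mu.-integrable `[T, (T + M)%R] (EFin \o (fun _ => k)).
  by apply: continuous_compact_integrable => //; apply: continuous_subspaceT => s; exact: cvg_cst.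
have I2 : mu.-integrable `[T, (T + M)%R] (EFin \o (fun s => G s + 2 * c ^+ 3)).
  apply: continuous_compact_integrable => //; apply: continuous_subspaceT => s.
  by apply: cvgD; [exact: cG|exact: cvg_cst].
have H : (\int[mu]_(s in `[T, (T + M)%R]) (w s)%:E <=
    \int[mu]_(s in `[T, (T + M)%R]) (G s + 2 * c ^+ 3)%:E)%E.
  by apply: le_integral => // s _; rewrite lee_fin.
move: H; rewrite FTC.
under eq_integral do rewrite EFinD.
rewrite (integralD _ IG (Ic _))// integral_cst//.
have mI : mu `[T, T + M]%classic = M%:E.
  by rewrite lebesgue_measure_itv/= lte_fin TM -EFinD addrC addKr.
rewrite [X in ((2 * c ^+ 3)%:E * X)%E](_ : _ = M%:E); last exact: mI.
rewrite -EFinM.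
have -> : 2 * c ^+ 3 * M = 2 * c ^+ 2 by rewrite /c; field; rewrite gt_eqF.
rewrite -leeBlDr// -EFinB; apply: le_trans.
rewrite lee_fin /W u0 mulr0 sub0r mulNr opprK -exprVn -/c.
have := sqr_ge0 c; nra.
Qed.

Lemma square_measure :
  (mu \x mu)%E (`[-1, 1]%classic `*` `[-1, 1]%classic) = 4%:E.
Proof.
rewrite product_measure1E//; try exact: measurable_itv.
have E : mu `[-1, 1]%classic = 2%:E.
  rewrite lebesgue_measure_itv/= lte_fin ifT; last by lra.
  by rewrite -EFinD; congr (_ %:E); ring.
transitivity (2%:E * 2%:E : \bar R)%E; first by congr (_ * _)%E; exact: E.
by rewrite -EFinM; congr (_ %:E); ring.
Qed.

Lemma product_sigma_finite : sigma_finite setT (mu \x mu)%E.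
Proof.
have /sigma_finiteP[F [TF ndF Foo]] := sigma_finiteT mu.
exists (fun n => F n `*` F n).
  rewrite -setXTT TF predeqE => -[x y]; split.
    move=> [/= [n _ Fnx] [k _ Gky]]; exists (maxn n k) => //; split.
    - by move: x Fnx; exact/subsetPset/ndF/leq_maxl.
    - by move: y Gky; exact/subsetPset/ndF/leq_maxr.
  by move=> [n _ []/= ? ?]; split; exists n.
move=> k; have [? ?] := Foo k.
split; first exact: measurableX.
by rewrite product_measure1E// lte_mul_pinfty// ge0_fin_numE.
Qed.

Lemma triple_tonelli (g : R * R * R -> \bar R) :
  measurable_fun setT g -> (forall x, 0 <= g x)%E ->
  (\int[((mu \x mu) \x mu)%E]_p g p = \int[(mu \x mu)%E]_p fubini_F mu g p)%E.
Proof.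
move=> mg g0.
(* mu \x mu has infinite mass, so it is sigma-finiteness that makes Tonelli's
   theorem applicable. *)
pose mm : {sigma_finite_measure set (measurableTypeR R * measurableTypeR R)%type -> \bar R} :=
  HB.pack (mu \x mu)%E
    (Measure_isSigmaFinite.Build _ _ _ (mu \x mu)%E product_sigma_finite).
exact: (@fubini_tonelli1 _ _ _ _ _ mm mu g mg g0).
Qed.

(** Only the part of the energy over the vertical segments standing on the square
    is kept; the square has area 4. *)
Lemma energy_ge (u : 'rV[R]_3 -> R) T M : smooth u -> 0 < M ->
  (forall x y, `|x| <= 1 -> `|y| <= 1 ->
    1 <= u (point3 x y T) /\ u (point3 x y (T + M)) = 0) ->
  ((M ^- 2 * 4)%:E <= energy u)%E.
Proof.
move=> su M0 H; rewrite /energy.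
set g := fun p : R * R * R => (enorm (grad u (point3 p.1.1 p.1.2 p.2)) ^+ 3)%:E.
have mg : measurable_fun setT g.
  apply: measurableT_comp => //.
  exact: (measurable_point3 (energy_density_continuous su)).
have g0 p : (0 <= g p)%E by rewrite lee_fin exprn_ge0// enorm_ge0.
pose S : set (R * R) := `[-1, 1]%classic `*` `[-1, 1]%classic.
have mS : measurable S by apply: measurableX; exact: measurable_itv.
have mF := measurable_fun_fubini_tonelli_F (m2 := mu) g mg g0.
have F0 p : (0 <= fubini_F mu g p)%E by apply: integral_ge0.
rewrite -/g (triple_tonelli mg g0).
apply: (@le_trans _ _ (\int[(mu \x mu)%E]_(p in S) fubini_F mu g p)%E); last first.
  by apply: ge0_subset_integral.
apply: (@le_trans _ _ (\int[(mu \x mu)%E]_(p in S) cst (M ^- 2)%:E p)%E).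
  rewrite integral_cst// [X in (_ * X)%E](_ : _ = 4%:E); last exact: square_measure.
  by rewrite -EFinM.
apply: ge0_le_integral => //.
- by move=> p _; rewrite lee_fin invr_ge0 exprn_ge0// ltW.
- exact: measurable_funTS.
- move=> [x y] [/=]; rewrite !in_itv/= -!ler_norml => x1 y1.
  have [u1 u0] := H x y x1 y1.
  apply: le_trans (vertical_energy su M0 u1 u0) _.
  rewrite /fubini_F; apply: ge0_subset_integral => //.
  apply: measurableT_comp => //; apply: continuous_measurable_fun => z.
  pose k v := enorm (grad u v) ^+ 3.
  have ck : continuous k by exact: energy_density_continuous.
  suff cz : point3 x y z' @[z' --> z] --> point3 x y z by exact: (cvg_comp _ k cz (ck _)).
  by apply: cvg_point3; [exact: cvg_cst..|exact: cvg_id].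
  by move=> z _; rewrite lee_fin exprn_ge0// enorm_ge0.
Qed.

Definition flat_square (T : R) : set 'rV[R]_3 :=
  [set x | [/\ `|x 0 0| <= 1, `|x 0 1| <= 1 & x 0 2 = T]].

Lemma flat_square_compact T : compact (flat_square T).
Proof.
pose A (i : 'I_3) : set R := if i == 2 then `[T, T]%classic else `[-1, 1]%classic.
have cA i : compact (A i) by rewrite /A; case: ifP => _; exact: segment_compact.
rewrite (_ : flat_square T = [set x | forall i, A i (x 0 i)]); first exact: rV_compact.
apply/seteqP; split => x /= => [[x0 x1 x2] i|H].
  by case: (ord3P i) => ->; rewrite /A/= in_itv/= ?x2 ?lexx// -ler_norml.
have := H 0; have := H 1; have := H 2; rewrite /A/= !in_itv/= -!ler_norml => /andP[T1 T2] x1 x0.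
by split=> //; apply/eqP; rewrite eq_le T1 T2.
Qed.

(** In a bounded condenser every admissible function vanishes at a common height
    T + M, so all energies stay above the same positive constant. *)
Lemma flat_square_capacity T : ~ compact_capacity_zero (flat_square T).
Proof.
move=> [A [oA [K [_ bA]] FA]].
pose B : R := `|K| + 1; have KB : K < B by rewrite ltr_pwDr// ler_norm.
pose M : R := B + `|T| + 1; have M0 : 0 < M by rewrite /M /B ltr_wpDl// addr_ge0// addr_ge0.
move=> cap0; have : ((M ^- 2 * 4)%:E <= condenser_capacity A (flat_square T))%E.
  apply: le_ereal_inf_tmp => _ [u [[su csupp suppA] u1] <-].
  apply: energy_ge => // x y x1 y1; split; first by apply: u1; rewrite /flat_square/= !point3E.
  apply/eqP; apply: contraT => un0.
  have /bA : A (point3 x y (T + M)) by apply: suppA; apply: subset_closure.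
  move=> /(_ B KB)/= /(le_trans (coord_le_norm _ 2)); rewrite point3E.
  rewrite leNgt => /negP[]; apply: lt_le_trans (ler_norm _).
  by rewrite /M; have := ler_norm (- T); rewrite normrN; lra.
by rewrite cap0 lee_fin leNgt mulr_gt0// invr_gt0 exprn_gt0.
Qed.
End CapacityOfSquare.

(** * A point has zero capacity *)

Section CapacityOfPoint.
Variable R : realType.
Local Notation mu := (@lebesgue_measure R).
Implicit Type x : 'rV[R]_3.

(** The gradient of [spike j] is of order 2 ^ j and lives on the ball of radius
    2 ^- j. *)
Lemma partial_spike_le j i x : `|partial (spike j) i x| <=
  4 * expR 1 * (2 ^+ j * (4 ^+ j * sqnorm x < 1)%R%:R).
Proof.
rewrite partial_spike; have [lt1|ge1] := ltrP (4 ^+ j * sqnorm x) 1; last first.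
  by rewrite /flat subr_gt0 ltNge ge1/= mulr0 normr0 !mulr0.
have /andP[f0 f2] := flatX2_bound (1 - 4 ^+ j * sqnorm x).
set ph := flat _ _ in f0 f2 *; clearbody ph.
have xi : `|2 ^+ j * x 0 i| <= 1.
  rewrite -(@ler_pXn2r _ 2)// ?nnegrE// real_normK ?num_real// expr1n.
  rewrite exprMn -exprM mulnC exprM (_ : 2 ^+ 2 = 4 :> R); last by ring.
  apply: le_trans (ltW lt1); rewrite ler_pM2l ?exprn_gt0// /sqnorm.
  have := sqr_ge0 (x 0 0); have := sqr_ge0 (x 0 1); have := sqr_ge0 (x 0 2).
  by case: (ord3P i) => ->; lra.
rewrite mulr1 (_ : expR 1 * _ * _ = (2 * expR 1 * 2 ^+ j) * (- (2 ^+ j * x 0 i) * ph)); last first.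
  rewrite (_ : 4 ^+ j = 2 ^+ j * 2 ^+ j :> R); first by ring.
  by rewrite -exprMn; congr (_ ^+ _); ring.
have E0 : 0 <= 2 * expR 1 * 2 ^+ j :> R by rewrite !mulr_ge0 ?expR_ge0 ?exprn_ge0.
rewrite normrM ger0_norm// normrM normrN [`|ph|]ger0_norm//.
rewrite (_ : 4 * _ * _ = 2 * expR 1 * 2 ^+ j * (1 * 2)); last by ring.
by rewrite ler_wpM2l// ler_pM.
Qed.

(** The nonzero terms are those of an initial segment of the indices, and such a
    sum of powers of 2 is at most twice its largest term: its cube is controlled
    by the sum of the cubes. *)
Lemma dyadic_cube (s : R) n : 0 <= s ->
  (\sum_(j < n) (2 : R) ^+ j * ((4 : R) ^+ j * s < 1)%R%:R) ^+ 3 <=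
  8 * \sum_(j < n) (8 : R) ^+ j * ((4 : R) ^+ j * s < 1)%R%:R.
Proof.
move=> s0; elim: n => [|n IHn]; first by rewrite !big_ord0 expr0n mulr0.
rewrite !big_ord_recr/=; case: ltrP => [lt1|_]; last by rewrite !mulr0 !addr0.
have H m : \sum_(j < m) (2 : R) ^+ j * ((4 : R) ^+ j * s < 1)%R%:R <= 2 ^+ m.
  elim: m => [|m IHm]; first by rewrite big_ord0.
  rewrite big_ord_recr/= exprS mulr2n mulrDl mul1r lerD//.
  by rewrite ler_piMr// lern1 leq_b1.
rewrite !mulr1; have := H n; set S := \sum_(j < n) _; set S' := \sum_(j < n) _.
move=> Sn; have S0 : 0 <= S by apply: sumr_ge0 => j _; rewrite mulr_ge0.
have S'0 : 0 <= S' by apply: sumr_ge0 => j _; rewrite mulr_ge0.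
apply: le_trans (_ : (2 ^+ n + 2 ^+ n) ^+ 3 <= _).
  by rewrite lerXn2r ?nnegrE ?addr_ge0// lerD2r.
rewrite (_ : (8 : R) ^+ n = 2 ^+ n * 2 ^+ n * 2 ^+ n).
  by rewrite mulrDr -[leLHS]add0r lerD ?mulr_ge0// le_eqVlt; apply/orP; left; apply/eqP; ring.
by rewrite -!exprMn; congr (_ ^+ _); ring.
Qed.

(** The spikes of scales 1, 1/2, ..., 2 ^- n all have energy of order 1, because
    the energy is scale invariant. By [dyadic_cube] their gradients hardly
    interact, so the mean of n + 1 of them has energy of order (n + 1) * (n + 1) ^- 3. *)
Definition spike_mean n x : R := n.+1%:R^-1 * \sum_(j < n.+1) spike j x.

Lemma spike_mean_smooth n : smooth_expr (spike_mean n).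
Proof. by rewrite /spike_mean; do ?constructor; apply: smooth_expr_sum => j; exact: spike_smooth. Qed.

(** The cube circumscribed to the ball of radius 2 ^- j, whose volume is easily
    computed in a product of measures. *)
Definition box (j : nat) : set (R * R * R) :=
  `[- (2 ^- j), 2 ^- j]%classic `*` `[- (2 ^- j), 2 ^- j]%classic `*`
  `[- (2 ^- j), 2 ^- j]%classic.

Lemma box_measurable j : measurable (box j).
Proof. by do 2 (apply: measurableX; last exact: measurable_itv); exact: measurable_itv. Qed.

Lemma box_measure j : ((mu \x mu) \x mu)%E (box j) = (8 * 8 ^- j)%:E.
Proof.
have E : mu `[- (2 ^- j), 2 ^- j]%classic = (2 * 2 ^- j)%:E.
  have p0 : 0 < 2 ^- j :> R by rewrite invr_gt0 exprn_gt0.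
  rewrite lebesgue_measure_itv/= lte_fin ifT; last by lra.
  by rewrite -EFinD; congr (_ %:E); ring.
rewrite product_measure1E; last first.
- exact: measurable_itv.
- by apply: measurableX; exact: measurable_itv.
transitivity ((2 * 2 ^- j)%:E * (2 * 2 ^- j)%:E * (2 * 2 ^- j)%:E : \bar R)%E.
  congr (_ * _)%E; last exact: E.
  rewrite [LHS]product_measure1E; try exact: measurable_itv.
  by congr (_ * _)%E; exact: E.
rewrite -!EFinM; congr (_ %:E).
rewrite (_ : (8 : R) ^+ j = 2 ^+ j * 2 ^+ j * 2 ^+ j).
  by rewrite !invfM; ring.
by rewrite -!exprMn; congr (_ ^+ _); ring.
Qed.

Lemma density_spike_mean n (p : R * R * R) :
  enorm (grad (spike_mean n) (point3 p.1.1 p.1.2 p.2)) ^+ 3 <=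
  \sum_(j < n.+1) (64 * 64 * expR 1 ^+ 3 / n.+1%:R ^+ 3 * 8 ^+ j) * \1_(box j) p.
Proof.
set x := point3 _ _ _.
pose S : R := \sum_(j < n.+1) (2 : R) ^+ j * ((4 : R) ^+ j * sqnorm x < 1)%R%:R.
have S0 : 0 <= S by apply: sumr_ge0 => j _; rewrite mulr_ge0.
pose m : R := n.+1%:R^-1 * (4 * expR 1) * S.
have m0 : 0 <= m by rewrite /m !mulr_ge0// expR_ge0.
have pm i : `|partial (spike_mean n) i x| <= m.
  rewrite /spike_mean partial_mul; last 2 first.
  - by apply: smooth_expr_diff; constructor.
  - by apply: smooth_expr_diff; apply: smooth_expr_sum => j; exact: spike_smooth.
  rewrite partial_const mulr0 addr0 partial_sum; last exact: spike_smooth.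
  rewrite normrM ger0_norm// /m -mulrA ler_wpM2l// mulr_sumr.
  apply: le_trans (ler_norm_sum _ _ _) _; apply: ler_sum => j _.
  exact: partial_spike_le.
have gm : enorm (grad (spike_mean n) x) <= 2 * m.
  apply: le_of_sqr; first by rewrite mulr_ge0.
  rewrite enorm3_sq !mxE.
  have sq i : partial (spike_mean n) i x ^+ 2 <= m ^+ 2.
    by rewrite -[leLHS]real_normK ?num_real// lerXn2r ?nnegrE.
  apply: le_trans (lerD (lerD (sq 0) (sq 1)) (sq 2)) _; rewrite [leRHS]exprMn.
  by move: (m ^+ 2) (sqr_ge0 m) => q; lra.
apply: le_trans (_ : (2 * m) ^+ 3 <= _).
  by rewrite lerXn2r ?nnegrE ?enorm_ge0 ?mulr_ge0.
rewrite (_ : (2 * m) ^+ 3 = 8 * 64 * expR 1 ^+ 3 / n.+1%:R ^+ 3 * S ^+ 3); last first.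
  by rewrite /m -exprVn; ring.
have sn0 : 0 <= sqnorm x by rewrite /sqnorm !addr_ge0 ?sqr_ge0.
have K0 : 0 <= 8 * 64 * expR 1 ^+ 3 / n.+1%:R ^+ 3 :> R.
  by rewrite !mulr_ge0 ?invr_ge0 ?exprn_ge0 ?expR_ge0.
apply: le_trans (ler_wpM2l K0 (dyadic_cube _ sn0)) _.
rewrite mulrA mulr_sumr; apply: ler_sum => j _.
rewrite mulrA (_ : 8 * 64 * _ / _ * 8 = 64 * 64 * expR 1 ^+ 3 / n.+1%:R ^+ 3); last by ring.
apply: ler_wpM2l; first by rewrite !mulr_ge0 ?invr_ge0 ?exprn_ge0 ?expR_ge0.
have [lt1|//] := ltrP (4 ^+ j * sqnorm x) 1.
suff H i : x 0 i \in `[- (2 ^- j), 2 ^- j].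
  rewrite indicE mem_set//; split; last by have := H 2; rewrite point3E.
  by split; [have := H 0|have := H 1]; rewrite point3E.
rewrite in_itv/= -ler_norml -(@ler_pXn2r _ 2)// ?nnegrE ?invr_ge0 ?exprn_ge0//.
rewrite real_normK ?num_real// exprVn -exprM mulnC exprM (_ : 2 ^+ 2 = 4 :> R); last by ring.
rewrite -[leRHS]mul1r ler_pdivlMr ?exprn_gt0// mulrC; apply: le_trans (ltW lt1).
rewrite ler_pM2l ?exprn_gt0// /sqnorm.
have := sqr_ge0 (x 0 0); have := sqr_ge0 (x 0 1); have := sqr_ge0 (x 0 2).
by case: (ord3P i) => ->; lra.
Qed.

Lemma energy_spike_mean n :
  (energy (spike_mean n) <= (8 * 64 * 64 * expR 1 ^+ 3 / n.+1%:R ^+ 2)%:E)%E.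
Proof.
rewrite /energy.
pose K : R := 64 * 64 * expR 1 ^+ 3 / n.+1%:R ^+ 3.
have K0 : 0 <= K by rewrite !mulr_ge0 ?invr_ge0 ?exprn_ge0 ?expR_ge0.
have mb (j : nat) : measurable_fun setT (fun p : R * R * R => (K * 8 ^+ j * \1_(box j) p)%:E).
  apply: measurableT_comp => //; apply: measurable_funM; first exact: measurable_cst.
  exact: (measurable_indic (box_measurable j)).
have b0 (j : nat) (p : R * R * R) : (0 <= (K * 8 ^+ j * \1_(box j) p)%:E)%E.
  by rewrite lee_fin !mulr_ge0// exprn_ge0.
apply: (@le_trans _ _ (\int[((mu \x mu) \x mu)%E]_p
    \sum_(j < n.+1) (K * 8 ^+ j * \1_(box j) p)%:E)%E).
  apply: ge0_le_integral => //.
  - by move=> p _; rewrite lee_fin exprn_ge0// enorm_ge0.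
  - apply: measurableT_comp => //.
    apply: (measurable_point3 (energy_density_continuous _)).
    exact: smooth_expr_smooth (spike_mean_smooth n).
  - apply: emeasurable_sum => j; exact: mb.
  - by move=> p _; rewrite sumEFin lee_fin; exact: density_spike_mean.
rewrite ge0_integral_sum//; last by move=> j; exact: mb.
under eq_bigr => j _.
  under eq_integral do rewrite EFinM.
  rewrite ge0_integralZl//; last 2 first.
  - by apply/measurable_EFinP; exact: (measurable_indic (box_measurable j)).
  - by rewrite lee_fin mulr_ge0// exprn_ge0.
  rewrite integral_indic//; last exact: box_measurable.
  rewrite setIT [X in (_ * X)%E](_ : _ = (8 * 8 ^- j)%:E); last exact: box_measure.
  rewrite -EFinM (_ : K * 8 ^+ j * (8 * 8 ^- j) = 8 * K); last first.
    have : (8 : R) ^+ j != 0 by rewrite expf_neq0.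
    by set w := _ ^+ j => w0; field.
  over.
rewrite sumEFin lee_fin sumr_const card_ord -mulr_natr /K le_eqVlt; apply/orP; left.
apply/eqP; have : n.+1%:R != 0 :> R by rewrite pnatr_eq0.
by set w := n.+1%:R => w0; field.
Qed.

(** All the means of spikes are admissible for the origin in the ball of radius
    2, and their energies tend to 0. *)
Lemma compact_capacity_zero_point (F : set 'rV[R]_3) :
  F `<=` [set 0] -> compact_capacity_zero F.
Proof.
move=> F0; exists (ball (0 : 'rV[R]_3) 2); split.
- exact: ball_open.
- exists 2; split; first exact: num_real.
  move=> M hM x; rewrite mx_norm_ball /ball_/= sub0r normrN => /ltW/le_trans; apply; exact: ltW.
- by move=> x /F0 ->; exact: ballxx.
apply/eqP; rewrite eq_le; apply/andP; split; last first.
  apply: le_ereal_inf_tmp => _ [u _ <-]; apply: integral_ge0 => p _.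
  by rewrite lee_fin exprn_ge0// enorm_ge0.
apply/lee_addgt0Pr => e e0; rewrite add0e.
pose C : R := 8 * 64 * 64 * expR 1 ^+ 3.
have C0 : 0 < C by rewrite mulr_gt0// exprn_gt0// expR_gt0.
have [n _ /(_ n (leqnn n)) nC] := near_infty_natSinv_lt (PosNum (divr_gt0 e0 C0)).
apply: ge_ereal_inf; exists (energy (spike_mean n)); last first.
  apply: le_trans (energy_spike_mean n) _; rewrite lee_fin -/C.
  move: nC => /=; rewrite ltr_pdivlMr// mulrC => /ltW; apply: le_trans.
  rewrite ler_pM2l// lef_pV2 ?posrE ?exprn_gt0 ?ltr0n//.
  by rewrite -[leLHS]expr1 ler_weXn2l// ler1n.
exists (spike_mean n) => //; split; last first.
  move=> x /F0 ->; rewrite /spike_mean.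
  under eq_bigr => j _.
    rewrite spikeE /sqnorm !mxE expr0n/= !addr0 mulr0 subr0 /flat ltr01.
    rewrite hornerC mul1r invr1 -expRD subrr expR0; over.
  by rewrite sumr_const card_ord -[_ *+ _]mulr_natr mul1r mulVf// pnatr_eq0.
have sub : closure [set x | spike_mean n x != 0] `<=` [set x | enorm x <= 1].
  rewrite -[X in _ `<=` X](_ : closure [set x | enorm (x : 'rV[R]_3) <= 1] = _).
    apply: closure_subset => x /= un0; rewrite leNgt; apply: contra un0 => x1.
    rewrite /spike_mean big1 ?mulr0// => j _; rewrite spikeE /flat ifF ?mulr0//.
    apply/negbTE; rewrite -leNgt subr_le0 /sqnorm -enorm3_sq.
    by rewrite mulr_ege1// exprn_ege1// ?ler1n// ltW.
  apply/esym/closure_id.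
  rewrite (_ : [set x | _] = (@enorm R 3) @^-1` [set t | t <= 1])//.
  apply: closed_comp => [x _|]; [exact: enorm_continuous|exact: closed_le].
split.
- exact: smooth_expr_smooth (spike_mean_smooth n).
- apply: bounded_closed_compact; last exact: closed_closure.
  exists 1; split; first exact: num_real.
  by move=> M hM x /sub/= x1; rewrite (le_trans (norm_le_enorm x))// (le_trans x1)// ltW.
- move=> x /sub/= x1; rewrite mx_norm_ball /ball_/= sub0r normrN.
  by rewrite (le_lt_trans (norm_le_enorm x))// (le_lt_trans x1)// ltr1n.
Qed.

End CapacityOfPoint.

(** * Geometric convergence *)

Section GeometricSequences.
Variable R : realType.

Lemma geometric_cvg (a : nat -> 'rV[R]_3) (C q : R) : 0 <= q < 1 -> 0 <= C ->
  (forall k, enorm (a k.+1 - a k) <= C * q ^+ k) ->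
  exists2 l : 'rV[R]_3, a k @[k --> \oo] --> l &
    forall k, enorm (l - a k) <= C / (1 - q) * q ^+ k.
Proof.
move=> /andP[q0 q1] C0 H; have q1' : 0 < 1 - q by rewrite subr_gt0.
have cvgi (i : 'I_3) : cvgn (fun k => a k 0 i).
  pose b k := a k.+1 0 i - a k 0 i.
  have sb : cvgn (series b).
    apply: normed_cvg; apply: (@series_le_cvg _ _ (fun k => C * q ^+ k)).
    - by move=> k; exact: normr_ge0.
    - by move=> k; rewrite mulr_ge0 ?exprn_ge0.
    - by move=> k; apply: le_trans (H k); apply: le_trans (coord_le_enorm _ i); rewrite !mxE.
    - by apply: is_cvg_geometric_series; rewrite ger0_norm.
  have -> : (fun k => a k 0 i) = (fun k => a 0%N 0 i + series b k).
    by apply/funext => k; rewrite /series/= telescope_sumr// addrC subrK.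
  by apply: is_cvgD => //; exact: is_cvg_cst.
pose l : 'rV[R]_3 := \row_i limn (fun k => a k 0 i).
have al : a k @[k --> \oo] --> l.
  have E k : a k = point3 (a k 0 0) (a k 0 1) (a k 0 2) by rewrite point3_eta.
  under eq_cvg do rewrite E.
  by rewrite -(point3_eta l) !mxE; apply: cvg_point3; exact: cvgi.
have bnd k j : enorm (a (k + j)%N - a k) <= C / (1 - q) * q ^+ k * (1 - q ^+ j).
  elim: j => [|j IHj].
    by rewrite addn0 subrr expr0 subrr mulr0 -(scale0r 0) enormZ normr0 mul0r.
  apply: le_trans (enorm_distD (a (k + j)%N) _ _) _.
  apply: le_trans (lerD (_ : _ <= C * q ^+ (k + j)) IHj) _; first by rewrite addnS.
  rewrite exprD exprS le_eqVlt; apply/orP; left; apply/eqP.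
  by field; rewrite gt_eqF.
exists l => // k; apply/ler_addgt0Pr => e e0.
have /cvg_enormP/(_ e e0) [N _ HN] := al.
have := HN (k + N)%N (leq_addl _ _) => /= lN.
apply: le_trans (enorm_distD (a (k + N)%N) _ _) _.
rewrite addrC; apply: lerD (ltW lN).
apply: le_trans (bnd k N) _; rewrite ler_piMr ?mulr_ge0 ?exprn_ge0 ?divr_ge0 ?invr_ge0 ?(ltW q1')//.
by rewrite lerBlDr lerDl exprn_ge0.
Qed.

Lemma small_power (q B e : R) : 0 <= q < 1 -> 0 < e ->
  exists2 k, (0 < k)%N & forall j, (k <= j)%N -> q ^+ j * B < e.
Proof.
move=> /andP[q0 q1] e0.
have B0 : 0 < `|B| + 1 by rewrite ltr_wpDl.
have : q ^+ k @[k --> \oo] --> (0 : R) by apply: cvg_expr; rewrite ger0_norm.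
move=> /cvgr0Pnorm_lt/(_ (e / (`|B| + 1))) []; first by rewrite divr_gt0.
move=> N _ HN; exists N.+1 => // j Nj.
have := HN j (ltnW Nj) => /=; rewrite ger0_norm ?exprn_ge0// ltr_pdivlMr//.
apply: le_lt_trans; rewrite ler_wpM2l ?exprn_ge0//.
by rewrite (le_trans (ler_norm _))// lerDl.
Qed.

End GeometricSequences.

(** * The Zorich map on a beam *)

Section ZorichDynamics.
Variables (R : realType) (L : R) (h : 'rV[R]_2 -> 'rV[R]_3) (Z : 'rV[R]_3 -> 'rV[R]_3).
Hypothesis hLip : bilipschitz_on (@square R) L h.
Hypothesis honto : h @` @square R = @upper_hemisphere R.
Hypothesis hZ : zorich_map h Z.
Variable lambda : R.
Hypothesis hlambda : 0 < lambda < expR (- (ln L + L)).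

Definition scaled_zorich (x : 'rV[R]_3) : 'rV[R]_3 := lambda *: Z x.
Local Notation f := scaled_zorich.
Implicit Types (x y z w : 'rV[R]_3) (n m : int) (u v : 'rV[R]_2).

Let lambda_gt0 : 0 < lambda. Proof. by case/andP: hlambda. Qed.

(** The map sends the plane x3 = t into the sphere of radius [rad t] around the
    origin. *)
Definition rad (t : R) : R := lambda * expR t.
Definition rad_inv (r : R) : R := ln (r / lambda).

Lemma rad_gt0 t : 0 < rad t. Proof. by rewrite mulr_gt0 ?expR_gt0. Qed.

Lemma radK : cancel rad rad_inv.
Proof. by move=> t; rewrite /rad /rad_inv mulrAC divff ?gt_eqF// mul1r expRK. Qed.

Lemma rad_invK r : 0 < r -> rad (rad_inv r) = r.
Proof. by move=> r0; rewrite /rad /rad_inv lnK ?posrE ?divr_gt0// mulrC divfK// gt_eqF. Qed.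

Lemma ler_rad : {mono rad : a b / a <= b}.
Proof. by move=> a b; rewrite /rad ler_pM2l// ler_expR. Qed.

Lemma ler_rad_inv a b : 0 < a -> a <= b -> rad_inv a <= rad_inv b.
Proof. by move=> a0 ab; rewrite -ler_rad !rad_invK//; exact: lt_le_trans ab. Qed.

Lemma ltr_rad_inv a b : 0 < a -> a < b -> rad_inv a < rad_inv b.
Proof.
move=> a0 ab; rewrite ltNge -ler_rad !rad_invK -?ltNge//; exact: lt_trans ab.
Qed.

(** Convexity: the graph lies above its tangent at b, whose slope is rad b. *)
Lemma rad_growth a b : rad b * (a - b) <= rad a - rad b.
Proof.
have -> : rad a = rad b * expR (a - b) by rewrite /rad -mulrA -expRD subrKC.
rewrite (_ : _ - rad b = rad b * (expR (a - b) - 1)); last by ring.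
by rewrite ler_pM2l ?rad_gt0// lerBrDl expR_ge1Dx.
Qed.

Lemma L_ge1 : 1 <= L.
Proof.
have [L0 H] := hLip; pose o : 'rV[R]_2 := point2 0 0; pose e : 'rV[R]_2 := point2 1 0.
have So : square o by rewrite /square/= /o !point2E normr0 ler01.
have Se : square e by rewrite /square/= /e !point2E normr0 normr1 ler01 lexx.
have oe : enorm (e - o) = 1.
  apply/eqP; rewrite -(@eqrXn2 _ 2) ?enorm_ge0// enorm2_sq !mxE/=.
  by apply/eqP; ring.
have /andP[H1 H2] := H _ _ Se So; move: H1 H2; rewrite oe !mulr1 => H1 H2.
rewrite leNgt; apply/negP => L1.
have : L^-1 <= L by exact: le_trans H2.
apply/negP; rewrite -ltNge; apply: (lt_trans L1).
by rewrite -[ltLHS]invr1 ltf_pV2 ?posrE.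
Qed.

Let L_gt0 : 0 < L. Proof. exact: lt_le_trans ltr01 L_ge1. Qed.

(** A point whose image lies above L lies itself above [height]; the bound on
    lambda makes [height] exceed L. The inverse branches of the map on the
    half-space above [height] will turn out to contract by the factor [contr]. *)
Definition height : R := rad_inv L.
Definition contr : R := L / height.

Lemma height_gtL : L < height.
Proof.
have /andP[_] := hlambda; rewrite -(ltr_ln _ _) ?posrE ?expR_gt0// expRK.
rewrite /height /rad_inv ln_div ?posrE//.
have := ln_ge0 L_ge1; lra.
Qed.

Lemma height_gt1 : 1 < height. Proof. exact: le_lt_trans L_ge1 height_gtL. Qed.
Lemma height_gt0 : 0 < height. Proof. exact: lt_trans ltr01 height_gt1. Qed.

Lemma contr_lt1 : 0 < contr < 1.
Proof. by rewrite divr_gt0// ?height_gt0//= ltr_pdivrMr ?height_gt0// mul1r height_gtL. Qed.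

Lemma inv_height_le : height^-1 <= contr.
Proof. by rewrite /contr -[leLHS]mul1r ler_wpM2r ?L_ge1// invr_ge0 ltW ?height_gt0. Qed.

(** This is the bound on lambda itself: everything at height at most L is
    mapped into the ball of radius 1 / L. *)
Lemma rad_L_lt : rad L < L^-1.
Proof.
have /andP[_] := hlambda; rewrite opprD expRD expRN lnK ?posrE// expRN.
by rewrite /rad => H; rewrite -ltr_pdivlMr ?expR_gt0.
Qed.

Lemma rad_inv_lip a b : height <= a -> height <= b ->
  `|rad_inv a - rad_inv b| <= contr * `|a - b|.
Proof.
wlog ab : a b / b <= a => [H ha hb|ha hb].
  have [ab|/ltW ab] := leP b a; first exact: H.
  by rewrite distrC [`|a - b|]distrC; exact: H.
have b0 : 0 < b by exact: lt_le_trans height_gt0 hb.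
have a0 : 0 < a by exact: lt_le_trans b0 ab.
rewrite !ger0_norm ?subr_ge0 ?ler_rad_inv//.
have := rad_growth (rad_inv a) (rad_inv b); rewrite !rad_invK//.
rewrite -ler_pdivlMl//; move/le_trans; apply.
rewrite ler_wpM2r ?subr_ge0//; apply: le_trans inv_height_le.
by rewrite lef_pV2 ?posrE ?height_gt0.
Qed.

Lemma rad_inv_height a : height <= a -> height <= rad_inv a.
Proof. by move=> ha; apply: ler_rad_inv => //; exact: le_trans (ltW height_gtL) ha. Qed.

Definition beam n m : set 'rV[R]_3 :=
  [set x | `|x 0 0 - 2 * n%:~R| <= 1 /\ `|x 0 1 - 2 * m%:~R| <= 1].

Definition fold_pt n m x : 'rV[R]_2 :=
  point2 ((-1) ^ n * (x 0 0 - 2 * n%:~R)) ((-1) ^ m * (x 0 1 - 2 * m%:~R)).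

Definition reflect n m (p : 'rV[R]_3) : 'rV[R]_3 :=
  point3 (p 0 0) (p 0 1) ((-1) ^ (n + m) * p 0 2).

Lemma sign_sq n : ((-1) ^ n : R) ^+ 2 = 1.
Proof. by rewrite expr2 -expfzMl mulrNN mulr1 exp1rz. Qed.

Lemma sign_norm n : `|(-1) ^ n : R| = 1.
Proof. by apply/eqP; rewrite -(@eqrXn2 _ 2)// real_normK ?num_real// sign_sq expr1n. Qed.

Lemma signP n : (-1) ^ n = 1 :> R \/ (-1) ^ n = -1 :> R.
Proof. by have /eqP := sign_sq n; rewrite sqrf_eq1 => /orP[]/eqP; [left|right]. Qed.

Lemma signS n : (-1) ^ (n + 1) = - (-1) ^ n :> R.
Proof. by rewrite expfzDr ?oppr_eq0 ?oner_eq0// expr1z mulrN1. Qed.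

Lemma fold_square n m x : beam n m x -> square (fold_pt n m x).
Proof.
by move=> [x0 x1]; split; rewrite /fold_pt !point2E normrM sign_norm mul1r.
Qed.

Lemma enorm_fold n m x y :
  enorm (fold_pt n m x - fold_pt n m y) ^+ 2 =
  (x 0 0 - y 0 0) ^+ 2 + (x 0 1 - y 0 1) ^+ 2.
Proof.
rewrite enorm2_sq !mxE/= -!mulrBr !exprMn !sign_sq !mul1r.
by congr (_ ^+ 2 + _ ^+ 2); ring.
Qed.

Lemma enorm_reflectB n m (p q : 'rV[R]_3) :
  enorm (reflect n m p - reflect n m q) = enorm (p - q).
Proof.
apply/eqP; rewrite -(@eqrXn2 _ 2) ?enorm_ge0// !enorm3_sq !mxE/= -mulrBr.
by rewrite exprMn sign_sq mul1r.
Qed.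

Lemma enorm_reflect n m (p : 'rV[R]_3) : enorm (reflect n m p) = enorm p.
Proof.
apply/eqP; rewrite -(@eqrXn2 _ 2) ?enorm_ge0// !enorm3_sq !mxE/=.
by rewrite exprMn sign_sq mul1r.
Qed.

Lemma h_hemisphere u : square u -> enorm (h u) = 1 /\ 0 <= h u 0 2.
Proof. by move=> Su; have : (h @` @square R) (h u) by [exists u]; rewrite honto. Qed.

Lemma map_beamE n m x : beam n m x ->
  f x = rad (x 0 2) *: reflect n m (h (fold_pt n m x)).
Proof. by move=> [x0 x1]; rewrite /f (hZ x0 x1)/= scalerA. Qed.

Lemma beam_cover x : exists n m, beam n m x.
Proof.
have H (t : R) : exists n : int, `|t - 2 * n%:~R| <= 1.
  exists (Num.floor ((t + 1) / 2)); have /andP[] := floor_itv ((t + 1) / 2).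
  rewrite intrD; set k := _%:~R => k1 k2; rewrite ler_norml.
  move: k1 k2; rewrite ler_pdivlMr// ltr_pdivrMr// => k1 k2.
  by apply/andP; split; lra.
by have [n Hn] := H (x 0 0); have [m Hm] := H (x 0 1); exists n, m.
Qed.

Lemma enorm_map x : enorm (f x) = rad (x 0 2).
Proof.
have [n [m b]] := beam_cover x; rewrite (map_beamE b) enormZ enorm_reflect.
by rewrite (h_hemisphere (fold_square b)).1 mulr1 gtr0_norm// rad_gt0.
Qed.

Lemma beam_sign n m x : beam n m x -> 0 < f x 0 2 -> (-1) ^ (n + m) = 1 :> R.
Proof.
move=> b; rewrite (map_beamE b) !mxE/= pmulr_rgt0 ?rad_gt0//.
have [_ h0] := h_hemisphere (fold_square b).
by case: (signP (n + m)) => // ->; rewrite mulN1r oppr_gt0 ltNge h0.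
Qed.

(** Adjacent beams have images on different sides of the plane y3 = 0, so a point
    mapped above this plane cannot lie on a side of its beam. *)
Lemma beam_unique n m n' m' x : 0 < f x 0 2 ->
  beam n m x -> beam n' m' x -> n = n' /\ m = m'.
Proof.
move=> fx0.
have strict (p q : int) : beam p q x -> `|x 0 0 - 2 * p%:~R| < 1 /\ `|x 0 1 - 2 * q%:~R| < 1.
  move=> b; have sb := beam_sign b fx0; case: (b) => b0 b1.
  have N (p' q' : int) : (-1) ^ (p' + q') = -1 :> R -> ~ beam p' q' x.
    by move=> s' /beam_sign/(_ fx0); rewrite s' => N1; lra.
  split; rewrite lt_neqAle ?b0 ?b1 andbT; apply/eqP => E.
  - have [E1|E1] := (leP 0 (x 0 0 - 2 * p%:~R)).
      apply: (N (p + 1) q); first by rewrite addrAC signS sb.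
      split=> //; move: E; rewrite ger0_norm// intrD => E.
      by rewrite (_ : _ - _ = -1) ?normrN1//; lra.
    apply: (N (p - 1) q).
      have := signS (p - 1 + q); rewrite addrAC subrK sb => sE.
      by rewrite -[LHS]opprK -sE.
    split=> //; move: E; rewrite ltr0_norm// intrD => E.
    by rewrite (_ : _ - _ = 1) ?normr1//; lra.
  - have [E1|E1] := (leP 0 (x 0 1 - 2 * q%:~R)).
      apply: (N p (q + 1)); first by rewrite addrA signS sb.
      split=> //; move: E; rewrite ger0_norm// intrD => E.
      by rewrite (_ : _ - _ = -1) ?normrN1//; lra.
    apply: (N p (q - 1)).
      have := signS (p + (q - 1)); rewrite -addrA subrK sb => sE.
      by rewrite -[LHS]opprK -sE.
    split=> //; move: E; rewrite ltr0_norm// intrD => E.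
    by rewrite (_ : _ - _ = 1) ?normr1//; lra.
have near_int (p q : int) (t : R) : `|t - 2 * p%:~R| < 1 -> `|t - 2 * q%:~R| < 1 -> p = q.
  rewrite !ltr_norml => /andP[p1 p2] /andP[q1 q2].
  have : (p%:~R : R) < (q + 1)%:~R by rewrite intrD; lra.
  have : (q%:~R : R) < (p + 1)%:~R by rewrite intrD; lra.
  by rewrite !ltr_int => H1 H2; lia.
move=> /strict[a1 a2] /strict[b1 b2]; split; [exact: near_int a1 b1|exact: near_int a2 b2].
Qed.

(** A beam is mapped onto one of the two closed half-spaces, the origin excepted;
    the sign tells which. *)
Lemma map_onto n m y : y != 0 -> 0 <= (-1) ^ (n + m) * y 0 2 ->
  exists x, [/\ beam n m x, f x = y & x 0 2 = rad_inv (enorm y)].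
Proof.
move=> y0 sy; have ny : 0 < enorm y.
  rewrite lt_neqAle enorm_ge0 andbT eq_sym; apply: contra y0 => /eqP H.
  exact/eqP/enorm0_eq0.
pose p := reflect n m ((enorm y)^-1 *: y).
have : (h @` @square R) p.
  rewrite honto; split.
    by rewrite enorm_reflect enormZ ger0_norm ?invr_ge0 ?enorm_ge0// mulVf// gt_eqF.
  by rewrite /p /reflect point3E mxE mulrCA mulr_ge0// invr_ge0 enorm_ge0.
case=> u [u0 u1] hu.
pose x : 'rV[R]_3 := point3 (2 * n%:~R + (-1) ^ n * u 0 0) (2 * m%:~R + (-1) ^ m * u 0 1)
   (rad_inv (enorm y)).
have b : beam n m x.
  by split; rewrite /x !point3E addrAC subrr add0r normrM sign_norm mul1r.
exists x; split=> //; last by rewrite /x point3E.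
rewrite (map_beamE b).
have -> : fold_pt n m x = u.
  apply: row2P; rewrite /fold_pt /x !point2E !point3E addrAC subrr add0r mulrA.
    by rewrite -expr2 sign_sq mul1r.
  by rewrite -expr2 sign_sq mul1r.
rewrite hu /x point3E rad_invK//.
apply: row3P; rewrite !mxE/= ?mulVKf ?gt_eqF//.
set sg := (-1) ^ (n + m).
rewrite (_ : _ * _ = enorm y / enorm y * sg ^+ 2 * y 0 2); last by ring.
by rewrite divff ?gt_eqF// /sg sign_sq !mul1r.
Qed.

(** The law of cosines, with the angle expressed by the chord |p - q|. *)
Lemma enorm_polar (r s : R) (p q : 'rV[R]_3) : enorm p = 1 -> enorm q = 1 ->
  enorm (r *: p - s *: q) ^+ 2 = (r - s) ^+ 2 + r * s * enorm (p - q) ^+ 2.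
Proof.
move=> p1 q1; have := enorm3_sq p; have := enorm3_sq q.
rewrite p1 q1 expr1n => hq hp; rewrite !enorm3_sq !mxE.
move: hp hq; set a := p 0 0; set b := p 0 1; set c := p 0 2.
set a' := q 0 0; set b' := q 0 1; set c' := q 0 2 => hp hq.
pose P := a * a' + b * b' + c * c'.
transitivity (r ^+ 2 * (a ^+ 2 + b ^+ 2 + c ^+ 2) +
  s ^+ 2 * (a' ^+ 2 + b' ^+ 2 + c' ^+ 2) - 2 * (r * s) * P); first by rewrite /P; ring.
transitivity ((r - s) ^+ 2 + r * s * ((a ^+ 2 + b ^+ 2 + c ^+ 2) +
  (a' ^+ 2 + b' ^+ 2 + c' ^+ 2) - 2 * P)); last by rewrite /P; ring.
by rewrite -hp -hq; ring.
Qed.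

Lemma map_dist n m x y : beam n m x -> beam n m y ->
  enorm (f x - f y) ^+ 2 = (rad (x 0 2) - rad (y 0 2)) ^+ 2 +
    rad (x 0 2) * rad (y 0 2) * enorm (h (fold_pt n m x) - h (fold_pt n m y)) ^+ 2.
Proof.
move=> bx b_y; rewrite (map_beamE bx) (map_beamE b_y) enorm_polar.
- by rewrite enorm_reflectB.
- by rewrite enorm_reflect (h_hemisphere (fold_square bx)).1.
- by rewrite enorm_reflect (h_hemisphere (fold_square b_y)).1.
Qed.

(** By [map_dist] the squared distance splits into a radial part and a spherical
    part. The radial part expands by at least the smaller radius, which is at
    least [height]; the spherical part expands by at least this radius divided by
    L, since h is bi-Lipschitz. Both factors are at least 1 / [contr]. *)
Lemma map_expanding n m x y : beam n m x -> beam n m y ->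
  height <= enorm (f x) -> height <= enorm (f y) ->
  enorm (x - y) <= contr * enorm (f x - f y).
Proof.
move=> bx b_y; rewrite !enorm_map => rx ry; have c0 := height_gt0.
apply: le_of_sqr; first by rewrite mulr_ge0 ?enorm_ge0// ltW//; case/andP: contr_lt1.
rewrite exprMn (map_dist bx b_y) enorm3_sq !mxE.
have [_ H] := hLip; have /andP[H1 _] := H _ _ (fold_square bx) (fold_square b_y).
have {H1} H1 : enorm (fold_pt n m x - fold_pt n m y) ^+ 2 <=
    L ^+ 2 * enorm (h (fold_pt n m x) - h (fold_pt n m y)) ^+ 2.
  rewrite -exprMn lerXn2r ?nnegrE ?mulr_ge0 ?enorm_ge0 ?(ltW L_gt0)//.
  by rewrite -ler_pdivrMl.
move: H1; rewrite enorm_fold; set e2 := enorm _ ^+ 2.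
set hor := _ + _ => H1.
have e0 : 0 <= e2 by exact: sqr_ge0.
(* [rad] grows with slope at least [height] between the two third coordinates. *)
have V : (x 0 2 - y 0 2) ^+ 2 <= height ^- 2 * (rad (x 0 2) - rad (y 0 2)) ^+ 2.
  rewrite ler_pdivlMl ?exprn_gt0// -exprMn.
  rewrite -[leLHS]real_normK ?num_real// -[leRHS]real_normK ?num_real//.
  rewrite lerXn2r ?nnegrE// normrM gtr0_norm//.
  have W (a b : R) : height <= rad b -> b <= a -> height * (a - b) <= rad a - rad b.
    move=> hb ba; apply: le_trans (rad_growth _ _).
    by rewrite ler_wpM2r// subr_ge0.
  have [xy|/ltW xy] := leP (y 0 2) (x 0 2).
    by rewrite !ger0_norm ?subr_ge0 ?ler_rad// W.
  by rewrite distrC [leRHS]distrC !ger0_norm ?subr_ge0 ?ler_rad// W.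
rewrite mulrDr [leRHS]addrC; apply: lerD.
- apply: le_trans H1 _.
  rewrite [leRHS]mulrA ler_wpM2r// /contr exprMn -mulrA ler_peMr ?exprn_ge0 ?(ltW L_gt0)//.
  by rewrite exprVn ler_pdivlMl ?exprn_gt0// mulr1 expr2 ler_pM// ltW.
- apply: le_trans V _; rewrite ler_wpM2r ?sqr_ge0// -exprVn.
  by rewrite lerXn2r ?nnegrE ?invr_ge0 ?(ltW c0)// ?inv_height_le// ltW//; case/andP: contr_lt1.
Qed.

Lemma map_lipschitz n m x y (t : R) : beam n m x -> beam n m y ->
  x 0 2 <= t -> y 0 2 <= t -> enorm (f x - f y) <= rad t * L * enorm (x - y).
Proof.
move=> bx b_y xt yt; have rt := rad_gt0 t.
have P0 : 0 <= rad t * L by rewrite mulr_ge0 ?(ltW rt) ?(ltW L_gt0).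
apply: le_of_sqr; first by rewrite mulr_ge0 ?enorm_ge0.
rewrite exprMn (map_dist bx b_y) [enorm (x - y) ^+ 2]enorm3_sq !mxE.
have [_ H] := hLip; have /andP[_ H2] := H _ _ (fold_square bx) (fold_square b_y).
have {H2} H2 : enorm (h (fold_pt n m x) - h (fold_pt n m y)) ^+ 2 <=
    L ^+ 2 * enorm (fold_pt n m x - fold_pt n m y) ^+ 2.
  by rewrite -exprMn lerXn2r ?nnegrE ?mulr_ge0 ?enorm_ge0 ?(ltW L_gt0).
move: H2; rewrite enorm_fold; set e2 := enorm _ ^+ 2.
set hor := (x 0 0 - y 0 0) ^+ 2 + (x 0 1 - y 0 1) ^+ 2 => H2.
have e0 : 0 <= e2 by exact: sqr_ge0.
have V : (rad (x 0 2) - rad (y 0 2)) ^+ 2 <= rad t ^+ 2 * (x 0 2 - y 0 2) ^+ 2.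
  rewrite -exprMn -[leLHS]real_normK ?num_real// -[leRHS]real_normK ?num_real//.
  rewrite lerXn2r ?nnegrE// normrM [`|rad t|]gtr0_norm//.
  have W (a b : R) : a <= t -> b <= a -> rad a - rad b <= rad t * (a - b).
    move=> at' ba; have := rad_growth b a.
    have : 0 <= (rad t - rad a) * (a - b) by rewrite mulr_ge0 ?subr_ge0 ?ler_rad.
    lra.
  have [xy|/ltW xy] := leP (y 0 2) (x 0 2).
    by rewrite !ger0_norm ?subr_ge0 ?ler_rad// W.
  by rewrite distrC [`|x 0 2 - _|]distrC !ger0_norm ?subr_ge0 ?ler_rad// W.
rewrite [leRHS]mulrDr [leLHS]addrC; apply: lerD.
- apply: le_trans (_ : rad t * rad t * (L ^+ 2 * hor) <= _).
    apply: ler_pM => //; first by rewrite mulr_ge0 ?(ltW (rad_gt0 _)).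
    by apply: ler_pM; rewrite ?ler_rad ?(ltW (rad_gt0 _)).
  by rewrite (_ : rad t * _ * _ = (rad t * L) ^+ 2 * hor)//; ring.
- apply: le_trans V _; rewrite ler_wpM2r ?sqr_ge0// [leRHS]exprMn.
  by rewrite ler_peMr ?exprn_ge0 ?(ltW rt)// exprn_ege1// L_ge1.
Qed.

(** Close to x, every point shares some closed beam with x, so the Lipschitz
    estimate in each beam is enough. *)
Lemma map_continuous : continuous f.
Proof.
move=> x.
have H (t : R) : exists2 d : R, 0 < d & forall s, `|t - s| < d ->
    exists n : int, `|t - 2 * n%:~R| <= 1 /\ `|s - 2 * n%:~R| <= 1.
  pose n := Num.floor ((t + 1) / 2); have /andP[] := floor_itv ((t + 1) / 2).
  rewrite -/n intrD ler_pdivlMr// ltr_pdivrMr//; set k : R := n%:~R => k1 k2.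
  have [t1|t1] := eqVneq t (2 * k - 1).
    exists 1 => // s; rewrite ltr_norml => /andP[s1 s2].
    have [st|st] := lerP (2 * k - 1) s.
      by exists n; rewrite -/k !ler_norml; split; apply/andP; split; lra.
    by exists (n - 1); rewrite intrB -/k !ler_norml; split; apply/andP; split; lra.
  have t1' : 2 * k - 1 < t by rewrite lt_neqAle eq_sym t1; lra.
  exists (Num.min (t - (2 * k - 1)) (2 * k + 1 - t)).
    by rewrite lt_min; apply/andP; split; lra.
  move=> s; rewrite lt_min !ltr_norml => /andP[/andP[s1 s2] /andP[s3 s4]].
  by exists n; rewrite -/k !ler_norml; split; apply/andP; split; lra.
have [d0 d00 H0] := H (x 0 0); have [d1 d10 H1] := H (x 0 1).
have FF : Filter (nbhs x) by exact: nbhs_filter.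
apply/(cvg_enormP FF) => e e0.
pose K := rad (x 0 2 + 1) * L; have K0 : 0 < K by rewrite mulr_gt0 ?rad_gt0.
near=> y.
have : forall i : 'I_3, `|x 0 i - y 0 i| < Num.min d0 d1.
  by near: y; apply: near_coord; rewrite lt_min d00.
have : forall i : 'I_3, `|x 0 i - y 0 i| < 1 by near: y; apply: near_coord.
have : enorm (x - y) < e / K by near: y; apply: near_enorm; rewrite divr_gt0.
move=> xy /(_ 2) y2 y01.
have [n [xn yn]] : exists n : int, `|x 0 0 - 2 * n%:~R| <= 1 /\ `|y 0 0 - 2 * n%:~R| <= 1.
  by apply: H0; have := y01 0; rewrite lt_min => /andP[].
have [m [xm ym]] : exists n : int, `|x 0 1 - 2 * n%:~R| <= 1 /\ `|y 0 1 - 2 * n%:~R| <= 1.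
  by apply: H1; have := y01 1; rewrite lt_min => /andP[].
apply: le_lt_trans (@map_lipschitz n m x y (x 0 2 + 1) _ _ _ _) _ => //.
- by lra.
- by move: y2; rewrite ltr_norml => /andP[]; lra.
- by rewrite -/K mulrC -ltr_pdivlMr.
Unshelve. all: by end_near. Qed.

Lemma iter_continuous k : continuous (iter k f).
Proof.
elim: k => [|k IHk] x; first exact: cvg_id.
have -> : iter k.+1 f = f \o iter k f by apply/funext.
exact: (cvg_comp (iter k f) f (IHk x) (@map_continuous _)).
Qed.

(** * The Julia set consists of the orbits that stay high *)

Definition high : set 'rV[R]_3 := [set x | forall k, L < iter k f x 0 2].

Lemma high_map x : high x -> high (f x).
Proof. by move=> Hx k; have := Hx k.+1; rewrite iterSr. Qed.

Lemma high_iter x k : high x -> high (iter k f x).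
Proof. by move=> Hx; elim: k => //= k; exact: high_map. Qed.

Lemma high_height x : high x -> height < x 0 2.
Proof.
move=> Hx; have := Hx 1%N => /= fx.
have : L < rad (x 0 2).
  by rewrite -enorm_map; apply: lt_le_trans fx (le_trans (ler_norm _) (coord_le_enorm _ 2)).
by move=> /(ltr_rad_inv L_gt0); rewrite radK.
Qed.

Lemma low_ball x : x 0 2 <= L -> enorm (f x) < L^-1.
Proof. by move=> x2; rewrite enorm_map; apply: le_lt_trans rad_L_lt; rewrite ler_rad. Qed.

Lemma ball_central x : enorm x < L^-1 -> beam 0 0 x /\ x 0 2 < L.
Proof.
move=> xL; have L1 : L^-1 <= 1 by rewrite invf_le1 ?L_ge1.
have H i : `|x 0 i| <= 1.
  by apply: le_trans (coord_le_enorm _ _) (le_trans (ltW xL) L1).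
split; first by split; rewrite mulr0 subr0.
apply: le_lt_trans (ler_norm _) _; apply: le_lt_trans (coord_le_enorm _ _) _.
by apply: lt_le_trans xL (le_trans L1 L_ge1).
Qed.

Lemma ball_iter x k : enorm x < L^-1 -> enorm (iter k f x) < L^-1.
Proof. by move=> xL; elim: k => //= k /ball_central[_ /ltW]; exact: low_ball. Qed.

Lemma not_high x : ~ high x -> exists k, enorm (iter k.+1 f x) < L^-1.
Proof.
move=> /existsNP[k]; move=> /negP; rewrite -leNgt => xk.
by exists k; rewrite iterS; exact: low_ball.
Qed.

(** Once below height L, the orbit enters the ball of radius 1 / L, which lies in
    the central beam, is mapped into itself and is contracted: the Lipschitz
    constant there is at most rad L * L < 1. *)
Lemma not_high_converges x : ~ high x ->
  exists p, f p = p /\ iter k f x @[k --> \oo] --> p.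
Proof.
move=> /not_high[k0 xk0]; set y := iter k0.+1 f x in xk0.
pose q := rad L * L.
have q01 : 0 <= q < 1.
  rewrite mulr_ge0 ?(ltW (rad_gt0 _)) ?(ltW L_gt0)//=.
  by rewrite -ltr_pdivlMr// mul1r rad_L_lt.
have step k : enorm (iter k.+1 f y - iter k f y) <= enorm (f y - y) * q ^+ k.
  elim: k => [|k IHk]; first by rewrite mulr1.
  have [b1 l1] := ball_central (ball_iter k.+1 xk0).
  have [b0 l0] := ball_central (ball_iter k xk0).
  apply: le_trans (map_lipschitz b1 b0 (ltW l1) (ltW l0)) _.
  by rewrite exprS mulrCA ler_wpM2l//; case/andP: q01.
have [p yp _] := geometric_cvg q01 (enorm_ge0 _) step.
have xp : iter k f x @[k --> \oo] --> p.
  have E : (fun k => iter (k + k0.+1)%N f x) = (fun k => iter k f y).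
    by apply/funext => k; rewrite iterD.
  by rewrite -(cvg_shiftn k0.+1) E.
exists p; split=> //.
have fp : f (iter k f y) @[k --> \oo] --> f p.
  exact: (cvg_comp _ f yp (@map_continuous p)).
have : iter k.+1 f y @[k --> \oo] --> p by rewrite (cvg_shiftS (fun k => iter k f y)).
move/(cvg_unique _ fp); apply; exact: norm_hausdorff.
Qed.

Lemma near_iter x k (e : R) : 0 < e ->
  \forall y \near x, enorm (iter k f x - iter k f y) < e.
Proof.
move=> e0; exact: ((cvg_enormP (nbhs_filter x) (iter k f) (iter k f x)).1 (@iter_continuous k x) e e0).
Qed.

Lemma near_bounded_forall (T : Type) (F : set_system T) (FF : Filter F)
    (P : nat -> T -> Prop) K : (forall k, \forall t \near F, P k t) ->
  \forall t \near F, forall k, (k < K)%N -> P k t.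
Proof.
move=> H; elim: K => [|K IHK]; first exact: nearW.
apply: filterS2 IHK (H K) => t IH HK k.
by rewrite ltnS leq_eqVlt => /orP[/eqP ->//|]; exact: IH.
Qed.

(** Near x the orbits remain below a common height T: the first iterates by
    continuity, the later ones because they are trapped in the ball of radius
    1 / L. Hence the orbit of a neighbourhood omits a flat square at height
    T + 1, which has positive capacity. *)
Lemma not_high_not_julia x : ~ high x -> ~ julia f x.
Proof.
move=> /not_high[k0 xk0] Jx; set K := k0.+1 in xk0.
pose S (j : nat) : R := `|iter j f x 0 2| + 1.
pose T : R := L + \sum_(j < K) S j.
pose U : set 'rV[R]_3 := [set y | enorm (iter K f y) < L^-1 /\
  forall j, (j < K)%N -> iter j f y 0 2 <= S j].
have nU : nbhs x U.
  have FF : Filter (nbhs x) by exact: nbhs_filter.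
  have N1 : \forall y \near x, enorm (iter K f y) < L^-1.
    have d0 : 0 < L^-1 - enorm (iter K f x) by rewrite subr_gt0.
    apply: filterS (@near_iter x K _ d0) => y Hy.
    have := enorm_distD (iter K f y) (iter K f x) 0.
    have := enorm_distD (iter K f x) (iter K f y) 0; rewrite !subr0 enormB; lra.
  have N2 : \forall y \near x, forall j, (j < K)%N -> iter j f y 0 2 <= S j.
    apply: (@near_bounded_forall _ _ FF (fun j (y : 'rV[R]_3) => iter j f y 0 2 <= S j) K) => j.
    apply: filterS (@near_iter x j _ ltr01) => y Hy.
    have := le_lt_trans (coord_le_enorm _ 2) Hy; rewrite !mxE ltr_norml => /andP[H1 H2].
    by rewrite /S; have := ler_norm (iter j f x 0 2); lra.
  exact: filterI N1 N2.
have S0 j : 0 <= S j by rewrite addr_ge0.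
have bounded y k : U y -> iter k f y 0 2 <= T.
  move=> [yK yj]; have [kK|Kk] := ltnP k K.
    apply: le_trans (yj _ kK) _; rewrite /T (bigD1 (Ordinal kK))//= addrCA lerDl.
    by rewrite addr_ge0 ?(ltW L_gt0)// sumr_ge0.
  have [_ l] : beam 0 0 (iter k f y) /\ iter k f y 0 2 < L.
    by apply: ball_central; rewrite -(subnK Kk) iterD; exact: ball_iter.
  by apply: le_trans (ltW l) _; rewrite /T lerDl sumr_ge0.
apply: (@flat_square_capacity R (T + 1)); apply: (Jx U nU).
  exact: flat_square_compact.
move=> z [_ _ z2] [k _ [y Uy yz]].
have := bounded y k Uy; rewrite yz z2; lra.
Qed.

(** Points near the orbit of x can be pulled back along it: at each step the
    inverse branch with values in the beam of the orbit contracts. *)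
Lemma pullback x y k : high x -> height <= y 0 2 -> exists y',
  [/\ height <= y' 0 2, iter k f y' = y &
      enorm (x - y') <= contr ^+ k * enorm (iter k f x - y)].
Proof.
move=> Hx; elim: k y => [|k IHk] y hy; first by exists y; rewrite mul1r.
have Hk := high_iter k Hx; have fk := high_iter k.+1 Hx.
have [n [m b]] := beam_cover (iter k f x).
have fpos : 0 < f (iter k f x) 0 2 by exact: lt_trans height_gt0 (high_height fk).
have y0 : y != 0.
  by apply: contraTneq hy => ->; rewrite mxE -ltNge height_gt0.
have ny : height <= enorm y.
  exact: le_trans hy (le_trans (ler_norm _) (coord_le_enorm _ _)).
have [|z [bz fz z2]] := @map_onto n m y y0.
  by rewrite (beam_sign b fpos) mul1r; exact: le_trans (ltW height_gt0) hy.
have hz : height <= z 0 2 by rewrite z2 rad_inv_height.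
have [y' [hy' fy' dy']] := IHk z hz.
exists y'; split=> //; first by rewrite iterS fy'.
apply: le_trans dy' _; rewrite exprSr -mulrA ler_wpM2l ?exprn_ge0//.
  by apply: ltW; case/andP: contr_lt1.
rewrite iterS -fz; apply: (map_expanding b bz); last by rewrite fz.
apply: le_trans (ltW (high_height fk)) _.
exact: le_trans (ler_norm _) (coord_le_enorm _ _).
Qed.

Lemma choose_sign n m (t : R) : exists m', (m' = m \/ m' = m + 1) /\
  0 <= (-1) ^ (n + m') * t.
Proof.
have [H|H] := leP 0 ((-1) ^ (n + m) * t); first by exists m; split; [left|].
by exists (m + 1); split; [right|rewrite addrA signS mulNr oppr_ge0 ltW].
Qed.

Lemma dist_via_centres (a b c d e : R) : `|a - c| <= 1 -> `|b - d| <= 1 ->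
  `|c - d| <= e -> `|a - b| <= 2 + e.
Proof.
rewrite !ler_norml => /andP[? ?] /andP[? ?] /andP[? ?]; apply/andP; split; lra.
Qed.

(** The iterates of a neighbourhood of x in [high] cover everything but the
    origin. Since k-fold pull-backs contract by contr ^ k, it suffices that a
    point w at bounded distance from iterate number k of x, the bound B being
    independent of k, be mapped to z by two further iterations. The first of them
    maps the beam of this iterate onto a half-space, and hits a preimage v of z
    lying in a beam whose distance from the origin is about r = |f (f^k x)|; so w
    has nearly the height of f^k x. The beam of v is chosen in its second index,
    and that of w likewise, so that the signs allow the preimages. *)
Lemma high_blowup x z (U : set 'rV[R]_3) : high x -> nbhs x U -> z != 0 ->
  exists k y, [/\ (1 <= k)%N, U y & iter k f y = z].
Proof.
move=> Hx /nbhs_enormP[rho rho0 HU] z0.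
have [tau tauE] : exists tau : R, tau = rad_inv (enorm z) by eexists.
have [B BE] : exists B : R, B = 13 + `|tau| by eexists.
have c01 : 0 <= contr < 1 by case/andP: contr_lt1 => /ltW -> ->.
have [k _ /(_ k (leqnn k)) kB] := small_power B c01 rho0.
set xk := iter k f x; have Hk : high xk by exact: high_iter.
have [r rE] : exists r : R, r = rad (xk 0 2) by eexists.
have r1 : 1 < r.
  rewrite rE -enorm_map; apply: lt_trans height_gt1 _.
  apply: lt_le_trans (high_height (high_map Hk)) _.
  exact: le_trans (ler_norm _) (coord_le_enorm _ _).
(* v has third coordinate tau whatever r is, so its norm is r up to 7 + |tau|. *)
have [n' [n'1 n'2]] : exists n' : int, r + 1 <= 2 * n'%:~R /\ 2 * n'%:~R <= r + 3.
  exists (Num.floor ((r + 1) / 2) + 1).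
  have /andP[] := floor_itv ((r + 1) / 2); rewrite !intrD; set a := _%:~R.
  by rewrite ler_pdivlMr// ltr_pdivrMr// => a1 a2; split; lra.
have [m' [m'E sz]] := choose_sign n' 0 (z 0 2).
have m'01 : 0 <= (m'%:~R : R) <= 1.
  by case: m'E => ->; rewrite ?add0r ?lexx ?ler01.
have [v [[bv0 bv1] fv v2]] := map_onto z0 sz.
have v0 : r <= v 0 0 <= r + 4.
  by move: bv0; rewrite ler_norml => /andP[]; lra.
have v1 : `|v 0 1| <= 3.
  by move: bv1 m'01; rewrite !ler_norml => /andP[a1 a2] /andP[b1 b2]; apply/andP; split; lra.
have rv : r <= enorm v.
  by case/andP: v0 => v0 _; apply: le_trans v0 (le_trans (ler_norm _) (coord_le_enorm _ _)).
have vr : enorm v <= r + 7 + `|tau|.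
  apply: le_trans (le_enorm_sum v) _; rewrite v2 -tauE ger0_norm; last by lra.
  by move: v0 v1 => /andP[]; lra.
have vN0 : v != 0.
  by apply: contraTneq v0 => ->; rewrite mxE; apply/negP => /andP[]; lra.
have [n [m [bx0 bx1]]] := beam_cover xk.
have [m2 [m2E sv]] := choose_sign n m (v 0 2).
have [w [[bw0 bw1] fw w2]] := map_onto vN0 sv.
have xw : xk 0 2 <= w 0 2.
  by rewrite w2 -[leLHS]radK -rE; apply: ler_rad_inv => //; lra.
have hw : height <= w 0 2 by apply: le_trans xw; exact: ltW (high_height Hk).
have w2B : w 0 2 - xk 0 2 <= 7 + `|tau|.
  have := rad_growth (w 0 2) (xk 0 2); rewrite -rE [rad (w 0 2)](_ : _ = enorm v); last first.
    by rewrite w2 rad_invK//; lra.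
  move=> H; apply: le_trans (_ : r * (w 0 2 - xk 0 2) <= _); last by lra.
  by rewrite ler_peMl ?subr_ge0// ltW.
have [y [hy fy dy]] := pullback k Hx hw.
exists k.+2, y; split=> //; last by rewrite !iterS fy fw.
apply: HU; apply: le_lt_trans dy _; apply: le_lt_trans kB.
rewrite ler_wpM2l ?exprn_ge0//; first by case/andP: c01.
apply: le_trans (le_enorm_sum _) _; rewrite !mxE -/xk BE.
have d0 : `|xk 0 0 - w 0 0| <= 2 + 0.
  by apply: dist_via_centres bx0 bw0 _; rewrite subrr normr0.
have d1 : `|xk 0 1 - w 0 1| <= 2 + 2.
  apply: dist_via_centres bx1 bw1 _; rewrite -mulrBr -intrB normrM ger0_norm//.
  rewrite ler_piMr//; case: m2E => ->; first by rewrite subrr normr0.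
  by rewrite opprD addrA subrr sub0r normrN1.
have d2 : `|xk 0 2 - w 0 2| <= 7 + `|tau|.
  by rewrite distrC ger0_norm ?subr_ge0.
lra.
Qed.

(** By [high_blowup] only the origin can be omitted, and it has zero capacity. *)
Lemma high_julia x : high x -> julia f x.
Proof.
move=> Hx U nU F cF FU; apply: compact_capacity_zero_point => z /FU zU.
apply: contrapT => /eqP z0; apply: zU.
have [k [y [k1 Uy yz]]] := high_blowup Hx nU z0.
by exists k => //; exists y.
Qed.

Lemma juliaE : julia f = high.
Proof.
apply/seteqP; split => x; last exact: high_julia.
by move=> Jx; apply: contrapT => /not_high_not_julia.
Qed.

(** * Itineraries *)

Implicit Types (s : nat -> int * int).

(** The itinerary s records the indices of the beams visited by an orbit. *)
Definition hair_of s : set 'rV[R]_3 :=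
  [set x | high x /\ forall k, beam (s k).1 (s k).2 (iter k f x)].

Lemma high_hair x : high x -> exists s, hair_of s x.
Proof.
move=> Hx; have H k : exists p : int * int, beam p.1 p.2 (iter k f x).
  by have [n [m b]] := beam_cover (iter k f x); exists (n, m).
by have [s Hs] := choice H; exists s.
Qed.

Lemma high_pos x : high x -> 0 < x 0 2.
Proof. by move=> /high_height; exact: lt_trans height_gt0. Qed.

Lemma high_enorm x : high x -> height <= enorm x.
Proof.
by move=> Hx; apply: le_trans (ltW (high_height Hx)) (le_trans (ler_norm _) (coord_le_enorm _ _)).
Qed.

Lemma hair_of_inj s s' x : hair_of s x -> hair_of s' x -> s = s'.
Proof.
move=> [Hx b] [_ b']; apply/funext => k.
have [e1 e2] := beam_unique (high_pos (high_iter k.+1 Hx)) (b k) (b' k).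
by apply/eqP; rewrite -pair_eqE/= e1 e2 !eqxx.
Qed.

Lemma hair_sign s x k : hair_of s x -> (-1) ^ ((s k).1 + (s k).2) = 1 :> R.
Proof. by move=> [Hx b]; exact: beam_sign (b k) (high_pos (high_iter k.+1 Hx)). Qed.

(** On each step both points lie in the same beam, where the map expands. *)
Lemma hair_expand s x y k : hair_of s x -> hair_of s y ->
  enorm (x - y) <= contr ^+ k * enorm (iter k f x - iter k f y).
Proof.
move=> [Hx bx] [Hy b_y]; elim: k => [|k IHk]; first by rewrite mul1r.
apply: le_trans IHk _; rewrite exprSr -mulrA ler_wpM2l ?exprn_ge0//.
  by apply: ltW; case/andP: contr_lt1.
rewrite !iterS; apply: (map_expanding (bx k) (b_y k)).
  exact: high_enorm (high_iter k.+1 Hx).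
exact: high_enorm (high_iter k.+1 Hy).
Qed.

Lemma same_beam n m x y : beam n m x -> beam n m y ->
  `|x 0 0 - y 0 0| <= 2 /\ `|x 0 1 - y 0 1| <= 2.
Proof.
have H (a b c : R) : `|a - c| <= 1 -> `|b - c| <= 1 -> `|a - b| <= 2.
  by move=> ac bc; rewrite -[leRHS]addr0; apply: dist_via_centres ac bc _; rewrite subrr normr0.
by move=> [x0 x1] [y0 y1]; split; [exact: H x0 y0|exact: H x1 y1].
Qed.

Lemma same_beam_enorm n m x y : beam n m x -> beam n m y ->
  enorm (x - y) <= 4 + `|x 0 2 - y 0 2|.
Proof.
move=> bx b_y; have [d0 d1] := same_beam bx b_y.
apply: le_trans (le_enorm_sum _) _; rewrite !mxE; lra.
Qed.

(** * The speed of escape orders each hair *)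

Lemma iter_rad_inv_height k (a : R) : height <= a -> height <= iter k rad_inv a.
Proof. by move=> ha; elim: k => //= k; exact: rad_inv_height. Qed.

Lemma iter_rad_inv_le k (a b : R) : height <= a -> a <= b ->
  iter k rad_inv a <= iter k rad_inv b.
Proof.
move=> ha ab; elim: k => //= k IHk; apply: ler_rad_inv => //.
exact: lt_le_trans height_gt0 (iter_rad_inv_height k ha).
Qed.

Lemma iter_rad_inv_lt k (a b : R) : height <= a -> a < b ->
  iter k rad_inv a < iter k rad_inv b.
Proof.
move=> ha ab; elim: k => //= k IHk; apply: ltr_rad_inv => //.
exact: lt_le_trans height_gt0 (iter_rad_inv_height k ha).
Qed.

Lemma iter_rad_inv_lip k (a b : R) : height <= a -> height <= b ->
  `|iter k rad_inv a - iter k rad_inv b| <= contr ^+ k * `|a - b|.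
Proof.
move=> ha hb; elim: k => [|k IHk]; first by rewrite mul1r.
rewrite !iterS; apply: le_trans (rad_inv_lip _ _) _; try exact: iter_rad_inv_height.
by rewrite exprS -mulrA ler_wpM2l//; apply: ltW; case/andP: contr_lt1.
Qed.

Lemma le_iter_rad_inv i (u a : R) : iter i rad u <= a -> u <= iter i rad_inv a.
Proof.
elim: i a => //= i IHi a H; rewrite -iterS iterSr; apply: IHi.
by rewrite -ler_rad rad_invK//; apply: lt_le_trans H; exact: rad_gt0.
Qed.

Lemma iter_rad_inv_leP k (a g : R) : height <= a ->
  iter k rad_inv a <= g -> a <= iter k rad g.
Proof.
elim: k a => // k IHk a ha; rewrite iterSr => H.
rewrite iterS -[a]rad_invK ?ler_rad; last exact: lt_le_trans height_gt0 ha.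
by apply: IHk => //; exact: rad_inv_height.
Qed.

Lemma iter_radK k : cancel (iter k rad) (iter k rad_inv).
Proof. by elim: k => // k IHk a; rewrite iterSr iterS radK IHk. Qed.

(** The third coordinate t of a point of the orbit is at most the radius [rad u]
    of the sphere containing it, u being the third coordinate of the point before.
    Undoing k times the radial growth brings the height of iterate number k back
    to the scale of x, and the levels so obtained decrease with k. Their limit is
    the starting height of the one-dimensional orbit of [rad] that escapes at the
    same rate as x; it will parametrize the hair of x. *)
Definition level k x : R := iter k rad_inv (iter k f x 0 2).
Definition speed x : R := inf [set level k x | k in [set: nat]].

Lemma level_height k x : high x -> height <= level k x.
Proof. by move=> Hx; apply: iter_rad_inv_height; exact: ltW (high_height (high_iter k Hx)). Qed.

Lemma third_le_rad x : f x 0 2 <= rad (x 0 2).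
Proof. by rewrite -enorm_map; exact: le_trans (ler_norm _) (coord_le_enorm _ _). Qed.

Lemma level_decr k j x : high x -> (k <= j)%N -> level j x <= level k x.
Proof.
move=> Hx; elim: j => [|j IHj]; first by rewrite leqn0 => /eqP ->.
rewrite leq_eqVlt => /orP[/eqP ->//|]; rewrite ltnS => /IHj; apply: le_trans.
rewrite /level iterSr; apply: iter_rad_inv_le.
  by apply: rad_inv_height; exact: ltW (high_height (high_iter j.+1 Hx)).
rewrite -[leRHS]radK; apply: ler_rad_inv; last exact: third_le_rad.
exact: high_pos (high_iter j.+1 Hx).
Qed.

Lemma speed_le k x : high x -> speed x <= level k x.
Proof.
move=> Hx; apply: ge_inf; last by exists k.
by exists height => _ [j _ <-]; exact: level_height.
Qed.

Lemma speed_ge (a : R) x : (forall k, a <= level k x) -> a <= speed x.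
Proof.
by move=> H; apply: lb_le_inf => [|_ [j _ <-]//]; exists (level 0 x); exists 0%N.
Qed.

Lemma speed_approx (c : R) x : speed x < c -> exists k, level k x < c.
Proof.
move=> sc; apply: contrapT => /forallNP H; move: sc; apply/negP; rewrite -leNgt.
by apply: speed_ge => k; rewrite leNgt; apply/negP; exact: H.
Qed.

Lemma speed_height x : high x -> height <= speed x.
Proof. by move=> Hx; apply: speed_ge => k; exact: level_height. Qed.

Lemma rad_add (t : R) (j : nat) : 2 ^+ j * rad t <= rad (t + j%:R).
Proof.
have e2 : 2 <= expR 1 :> R by apply: le_trans (expR_ge1Dx 1).
rewrite (_ : rad (t + _) = rad t * expR j%:R); last by rewrite /rad expRD mulrA.
rewrite [leLHS]mulrC ler_pM2l ?rad_gt0//.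
by rewrite -[j%:R]mulr1 expRM_natl lerXn2r ?nnegrE ?expR_ge0.
Qed.

(** Let x and y have the same itinerary and let x be 4 higher. Then f x is at
    least 16 times as far from the origin as f y, while its first two coordinates
    are within 2 of those of f y; so its third coordinate carries most of its
    norm, and f x is again 4 higher than f y. For the same reason the orbit of x
    follows from above that of u = x3 - 2 under [rad]. *)
Lemma gap_step n m x y (u : R) : high x -> high y -> beam n m (f x) -> beam n m (f y) ->
  y 0 2 + 4 <= x 0 2 -> u + 2 <= x 0 2 ->
  f y 0 2 + 4 <= f x 0 2 /\ rad u + 2 <= f x 0 2.
Proof.
move=> Hx Hy bx b_y yx ux.
have [d0 d1] := same_beam bx b_y.
pose r := enorm (f x); pose r' := enorm (f y).
have r'1 : 1 < r' by exact: lt_le_trans height_gt1 (high_enorm (high_map Hy)).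
have rr' : 16 * r' <= r.
  rewrite /r /r' !enorm_map; apply: le_trans (_ : rad (y 0 2 + 4%:R) <= _).
    apply: le_trans (rad_add (y 0 2) 4); rewrite ler_pM2r ?rad_gt0//.
    by rewrite le_eqVlt; apply/orP; left; apply/eqP; ring.
  by rewrite ler_rad.
have ru : 4 * rad u <= r.
  rewrite /r enorm_map; apply: le_trans (_ : rad (u + 2%:R) <= _).
    apply: le_trans (rad_add u 2); rewrite ler_pM2r ?rad_gt0//.
    by rewrite le_eqVlt; apply/orP; left; apply/eqP; ring.
  by rewrite ler_rad.
have a0 : `|f x 0 0| <= r' + 2.
  have := ler_normD (f x 0 0 - f y 0 0) (f y 0 0); rewrite subrK.
  have := coord_le_enorm (f y) 0; rewrite -/r'; move: d0; lra.
have a1 : `|f x 0 1| <= r' + 2.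
  have := ler_normD (f x 0 1 - f y 0 1) (f y 0 1); rewrite subrK.
  have := coord_le_enorm (f y) 1; rewrite -/r'; move: d1; lra.
have := le_enorm_sum (f x); rewrite -/r [`|f x 0 2|]gtr0_norm; last exact: high_pos (high_map Hx).
have y2 : f y 0 2 <= r' by exact: le_trans (ler_norm _) (coord_le_enorm _ _).
move: (f x 0 2) (f y 0 2) a0 a1 y2 rr' ru r'1.
move: `|f x 0 0| `|f x 0 1| r r' (rad u); move=> A B ra rb ru2 X Y ? ? ? ? ? ? ?.
by split; lra.
Qed.

Lemma gap_persists s x y k (u : R) i : hair_of s x -> hair_of s y ->
  iter k f y 0 2 + 4 <= iter k f x 0 2 -> u + 2 <= iter k f x 0 2 ->
  iter (i + k) f y 0 2 + 4 <= iter (i + k) f x 0 2 /\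
  iter i rad u + 2 <= iter (i + k) f x 0 2.
Proof.
move=> [Hx bx] [Hy b_y] yx ux; elim: i => [//|i [IH1 IH2]].
rewrite addSn !iterS.
exact: (gap_step (high_iter _ Hx) (high_iter _ Hy) (bx (i + k).+1) (b_y (i + k).+1)).
Qed.

(** The orbit of the number x3 - 2 under [rad] stays below the one of x, and
    [rad_inv] brings it back to its start. *)
Lemma gap_speed s x y k : hair_of s x -> hair_of s y ->
  iter k f y 0 2 + 4 <= iter k f x 0 2 ->
  iter k rad_inv (iter k f x 0 2 - 2) <= speed x.
Proof.
move=> hx hy yx; pose u := iter k f x 0 2 - 2.
have hu : height <= u.
  have := high_height (high_iter k hy.1); rewrite /u; move: yx; lra.
have H i : iter k rad_inv u <= level (i + k) x.
  have ux : u + 2 <= iter k f x 0 2 by rewrite /u subrK.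
  have [_ ui] := gap_persists i hx hy yx ux.
  rewrite /level addnC iterD; apply: iter_rad_inv_le => //.
  apply: le_iter_rad_inv; rewrite addnC; move: ui; lra.
apply: speed_ge => j; have [kj|/ltnW jk] := leqP k j.
  by rewrite -(subnK kj).
by apply: le_trans (H 0%N) _; apply: level_decr => //; case: hx.
Qed.

Lemma gap_speed_lt s x y k : hair_of s x -> hair_of s y ->
  iter k f y 0 2 + 4 <= iter k f x 0 2 -> speed y < speed x.
Proof.
move=> hx hy yx; apply: lt_le_trans (gap_speed hx hy yx).
apply: le_lt_trans (speed_le k hy.1) _; apply: iter_rad_inv_lt.
  exact: ltW (high_height (high_iter k hy.1)).
by move: yx; lra.
Qed.

(** Distances grow by 1 / contr at each step while the horizontal ones stay
    bounded, so two points of a hair are eventually far apart in height. *)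
Lemma hair_gap s x y (D : R) : hair_of s x -> hair_of s y -> x != y ->
  exists k, D <= `|iter k f x 0 2 - iter k f y 0 2|.
Proof.
move=> hx hy xy.
have d0 : 0 < enorm (x - y).
  rewrite lt_neqAle enorm_ge0 andbT eq_sym; apply: contra xy => /eqP/enorm0_eq0 H.
  by rewrite -subr_eq0 H.
have c01 : 0 <= contr < 1 by case/andP: contr_lt1 => /ltW -> ->.
have [k _ /(_ k (leqnn k)) kD] := small_power (4 + D) c01 d0.
exists k; rewrite leNgt; apply/negP => lt; move: kD; apply/negP; rewrite -leNgt.
apply: le_trans (hair_expand k hx hy) _; rewrite ler_wpM2l ?exprn_ge0//.
  by case/andP: c01.
apply: le_trans (same_beam_enorm (hx.2 k) (hy.2 k)) _.
by rewrite lerD2l ltW.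
Qed.

Lemma speed_inj s x y : hair_of s x -> hair_of s y -> speed x = speed y -> x = y.
Proof.
move=> hx hy e; apply/eqP; apply: contraT => /(hair_gap 4 hx hy)[k].
case: (leP 0 (iter k f x 0 2 - iter k f y 0 2)) => [p|n].
  rewrite ger0_norm// lerBrDl => H.
  by have := gap_speed_lt hx hy H; rewrite e ltxx.
rewrite ltr0_norm// opprB lerBrDl => H.
by have := gap_speed_lt hy hx H; rewrite e ltxx.
Qed.

(** If the speeds of x and y are close, then their orbits cannot have a gap of 4
    at time K, since [gap_speed] bounds the difference of speeds below by a
    constant depending only on y. At time K the two orbits are then at distance
    at most 8, hence x and y at distance at most contr ^ K * 8. *)
Lemma speed_inv_cont s y (e : R) : hair_of s y -> 0 < e ->
  exists2 d : R, 0 < d &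
    forall x, hair_of s x -> `|speed y - speed x| < d -> enorm (y - x) < e.
Proof.
move=> hy e0.
have c01 : 0 <= contr < 1 by case/andP: contr_lt1 => /ltW -> ->.
have [K _ /(_ K (leqnn K)) Ke] := small_power 8 c01 e0.
pose a := iter K f y 0 2.
have ha : height <= a by exact: ltW (high_height (high_iter K hy.1)).
pose d1 := iter K rad_inv (a + 2) - iter K rad_inv a.
have d10 : 0 < d1 by rewrite subr_gt0; apply: iter_rad_inv_lt => //; rewrite ltrDl.
(* If a - 4 < height, no orbit in the hair can be 4 lower than that of y at time
   K, and any positive value of d2 will do. *)
pose d2 := if height <= a - 4 then iter K rad_inv (a - 2) - iter K rad_inv (a - 4) else 1.
have d20 : 0 < d2.
  rewrite /d2; case: ifP => // h4; rewrite subr_gt0; apply: iter_rad_inv_lt => //.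
  by rewrite ltrD2l ltrN2 ltr_nat.
exists (Num.min d1 d2); first by rewrite lt_min d10.
move=> x hx; rewrite lt_min => /andP[]; rewrite !ltr_norml => /andP[l1 _] /andP[_ l2].
apply: le_lt_trans (hair_expand K hy hx) _; apply: le_lt_trans Ke.
rewrite ler_wpM2l ?exprn_ge0//; first by case/andP: c01.
apply: le_trans (same_beam_enorm (hy.2 K) (hx.2 K)) _.
suff : `|a - iter K f x 0 2| <= 4 by rewrite /a; lra.
rewrite ler_norml; apply/andP; split; rewrite leNgt; apply/negP => H.
- have yx : iter K f y 0 2 + 4 <= iter K f x 0 2 by move: H; rewrite -/a; lra.
  have S1 := gap_speed hx hy yx; have S2 := speed_le K hy.1.
  have : iter K rad_inv (a + 2) <= iter K rad_inv (iter K f x 0 2 - 2).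
    apply: iter_rad_inv_le; first by move: ha; lra.
    by move: yx; rewrite -/a; lra.
  by move: l1 S1 S2; rewrite /d1 /level -/a; lra.
- have xy : iter K f x 0 2 + 4 <= iter K f y 0 2 by move: H; rewrite -/a; lra.
  have S1 := gap_speed hy hx xy; have S2 := speed_le K hx.1.
  have hxK : height <= iter K f x 0 2 by exact: ltW (high_height (high_iter K hx.1)).
  have xa : iter K f x 0 2 <= a - 4 by move: xy; rewrite -/a; lra.
  have h4 : height <= a - 4 by exact: le_trans hxK xa.
  have := iter_rad_inv_le K hxK xa.
  by move: l2 S1 S2; rewrite /d2 h4 /level -/a; lra.
Qed.

(** A gap of 5 between the orbits of y and z, at some time, persists as a gap of 4
    for the points near y. *)
Lemma speed_gt_near s y z : hair_of s y -> hair_of s z -> speed z < speed y ->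
  \forall x \near y, hair_of s x -> speed z < speed x.
Proof.
move=> hy hz zy.
have yz : y != z by apply: contraTneq zy => ->; rewrite ltxx.
have [k kD] := hair_gap 5 hy hz yz.
have gap : iter k f z 0 2 + 5 <= iter k f y 0 2.
  move: kD; case: (leP 0 (iter k f y 0 2 - iter k f z 0 2)) => [p|n].
    by rewrite ger0_norm// lerBrDl.
  rewrite ltr0_norm// opprB => H.
  have H4 : iter k f y 0 2 + 4 <= iter k f z 0 2 by move: H; lra.
  by have := lt_trans zy (gap_speed_lt hz hy H4); rewrite ltxx.
apply: filterS (@near_iter y k _ ltr01) => x yx hx.
apply: (gap_speed_lt hx hz (k := k)).
have := le_lt_trans (coord_le_enorm _ 2) yx; rewrite !mxE ltr_norml => /andP[_ H].
by move: gap H; lra.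
Qed.

(** Speed is an infimum of continuous functions. *)
Lemma speed_lt_near s y (c : R) : hair_of s y -> speed y < c ->
  \forall x \near y, hair_of s x -> speed x < c.
Proof.
move=> hy /speed_approx[k kc].
have e0 : 0 < c - level k y by rewrite subr_gt0.
apply: filterS (@near_iter y k _ e0) => x yx hx.
apply: le_lt_trans (speed_le k hx.1) _.
have hxk : height <= iter k f x 0 2 by exact: ltW (high_height (high_iter k hx.1)).
have hyk : height <= iter k f y 0 2 by exact: ltW (high_height (high_iter k hy.1)).
have := le_lt_trans (coord_le_enorm _ 2) yx; rewrite !mxE distrC => H.
have c1 : contr ^+ k <= 1.
  by apply: exprn_ile1; [apply: ltW|apply: ltW]; case/andP: contr_lt1.
have := iter_rad_inv_lip k hxk hyk; rewrite -/(level k x) -/(level k y) => H2.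
have {H2} : level k x - level k y <= `|iter k f x 0 2 - iter k f y 0 2|.
  apply: le_trans (ler_norm _) (le_trans H2 _).
  by rewrite ler_piMl.
by move: H; lra.
Qed.

(** * Existence of points with given itinerary and speed *)

Lemma limit_coord (a : nat -> 'rV[R]_3) (l : 'rV[R]_3) i (P : R -> Prop) :
  (forall t, (forall e : R, 0 < e -> exists2 t', P t' & `|t - t'| < e) -> P t) ->
  (forall j, P (a j 0 i)) -> a j @[j --> \oo] --> l -> P (l 0 i).
Proof.
move=> clP Pa /cvg_enormP al; apply: clP => e e0.
have [N _ /(_ N (leqnn N)) H] := al e e0.
exists (a N 0 i) => //; apply: le_lt_trans H.
by apply: le_trans (coord_le_enorm _ i); rewrite !mxE.
Qed.

Lemma interval_closed_approx (c t : R) :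
  (forall e : R, 0 < e -> exists2 t', `|t' - c| <= 1 & `|t - t'| < e) -> `|t - c| <= 1.
Proof.
move=> H; apply/ler_addgt0Pr => e e0; have [t' t'c tt'] := H e e0.
have := ler_normD (t - t') (t' - c); rewrite addrA subrK; lra.
Qed.

Lemma ge_closed_approx (c t : R) :
  (forall e : R, 0 < e -> exists2 t', c <= t' & `|t - t'| < e) -> c <= t.
Proof.
move=> H; apply/ler_addgt0Pr => e e0; have [t' t'c] := H e e0.
rewrite ltr_norml => /andP[]; lra.
Qed.

(** A pseudo-orbit w with the itinerary s is followed by a true orbit. Pulling
    w (k + j) back along s to time k gives points A j k; passing from j to j + 1
    moves them by at most C * contr ^ j, so they converge, and their limits form
    an orbit. *)
Lemma shadow s (w : nat -> 'rV[R]_3) (C : R) :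
  (forall k, (-1) ^ ((s k).1 + (s k).2) = 1 :> R) ->
  (forall k, beam (s k).1 (s k).2 (w k)) -> (forall k, height <= w k 0 2) ->
  (forall k, 4 + `|rad_inv (enorm (w k.+1)) - w k 0 2| <= C) ->
  exists2 y, hair_of s y & forall k, enorm (iter k f y - w k) <= C / (1 - contr).
Proof.
move=> sgn bw hw HC.
have C0 : 0 <= C by apply: le_trans (HC 0%N); rewrite addr_ge0.
have [lam lamP] : exists lam : nat -> 'rV[R]_3 -> 'rV[R]_3,
    forall k (v : 'rV[R]_3), height <= v 0 2 ->
    [/\ beam (s k).1 (s k).2 (lam k v), f (lam k v) = v &
        lam k v 0 2 = rad_inv (enorm v)].
  have H k (v : 'rV[R]_3) : exists z, height <= v 0 2 ->
      [/\ beam (s k).1 (s k).2 z, f z = v & z 0 2 = rad_inv (enorm v)].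
    have [hv|hv] := boolP (height <= v 0 2); last by exists 0.
    have v0 : v != 0.
      by apply: contraTneq hv => ->; rewrite mxE -ltNge height_gt0.
    have [|z Hz] := @map_onto (s k).1 (s k).2 v v0; last by exists z.
    by rewrite sgn mul1r; exact: le_trans (ltW height_gt0) hv.
  exists (fun k (v : 'rV[R]_3) => projT1 (cid (H k v))) => k v hv.
  by case: cid => z /= Hz; exact: Hz.
pose A := fix A (j k : nat) {struct j} : 'rV[R]_3 :=
  if j is j'.+1 then lam k (A j' k.+1) else w k.
have le_en (v : 'rV[R]_3) : v 0 2 <= enorm v by exact: le_trans (ler_norm _) (coord_le_enorm _ _).
have hA j k : height <= A j k 0 2.
  elim: j k => [|j IHj] k //=; have [_ _ ->] := lamP k _ (IHj k.+1).
  exact: rad_inv_height (le_trans (IHj k.+1) (le_en _)).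
have bA j k : beam (s k).1 (s k).2 (A j k).
  by case: j => [|j] //=; have [] := lamP k _ (hA j k.+1).
have fA j k : f (A j.+1 k) = A j k.+1 by have [] := lamP k _ (hA j k.+1).
have step j k : enorm (A j.+1 k - A j k) <= C * contr ^+ j.
  elim: j k => [|j IHj] k.
    rewrite mulr1; apply: le_trans (same_beam_enorm (bA 1%N k) (bA 0%N k)) _.
    by have [_ _ /= ->] := lamP k _ (hw k.+1); exact: HC.
  apply: le_trans (map_expanding (bA j.+2 k) (bA j.+1 k) _ _) _; rewrite ?fA.
  - exact: le_trans (hA _ _) (le_en _).
  - exact: le_trans (hA _ _) (le_en _).
  - by rewrite exprS mulrCA ler_wpM2l// ltW//; case/andP: contr_lt1.
have c01 : 0 <= contr < 1 by case/andP: contr_lt1 => /ltW -> ->.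
have HY k : exists Y : 'rV[R]_3, A j k @[j --> \oo] --> Y /\ enorm (Y - w k) <= C / (1 - contr).
  have [Y AY bY] := geometric_cvg c01 C0 (fun j => step j k).
  by exists Y; split=> //; have := bY 0%N; rewrite mulr1.
have {HY} [Y HY] := choice HY.
have fY k : f (Y k) = Y k.+1.
  have [AY _] := HY k; have [AY' _] := HY k.+1.
  have H1 : f (A j k) @[j --> \oo] --> f (Y k).
    exact: (cvg_comp _ f AY (@map_continuous _)).
  move: H1; rewrite -(cvg_shiftS (fun j => f (A j k))) => H1.
  have E : (fun j => f (A j.+1 k)) = (fun j => A j k.+1) by apply/funext => j; exact: fA.
  rewrite E in H1; apply: (cvg_unique _ H1 AY'); exact: norm_hausdorff.
have iY k : iter k f (Y 0%N) = Y k by elim: k => //= k ->; exact: fY.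
exists (Y 0%N) => [|k]; last by rewrite iY; case: (HY k).
split=> k; rewrite iY.
  apply: lt_le_trans height_gtL _.
  apply: (limit_coord (P := fun t => height <= t)) (HY k).1 => //.
  exact: ge_closed_approx.
by split; [apply: (limit_coord (P := fun t => `|t - 2 * (s k).1%:~R| <= 1)) (HY k).1
  |apply: (limit_coord (P := fun t => `|t - 2 * (s k).2%:~R| <= 1)) (HY k).1];
  try exact: interval_closed_approx; move=> j; have [] := bA j k.
Qed.

Lemma centre_beam n m (t : R) : beam n m (point3 (2 * n%:~R) (2 * m%:~R) t).
Proof. by split; rewrite !point3E subrr normr0. Qed.

(** The centres of the beams at constant height form a pseudo-orbit with bounded
    errors. *)
Lemma hair_of_bounded s : (forall k, (-1) ^ ((s k).1 + (s k).2) = 1 :> R) ->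
  (forall k, `|(s k).1%:~R| <= (1 : R) /\ `|(s k).2%:~R| <= (1 : R)) -> hair_of s !=set0.
Proof.
move=> sgn bs; pose w k : 'rV[R]_3 := point3 (2 * (s k).1%:~R) (2 * (s k).2%:~R) height.
have h0 := height_gt0.
have [|||y hy _] := @shadow s w (4 + (rad_inv (4 + height) - height)) sgn; last by exists y.
- by move=> k; exact: centre_beam.
- by move=> k; rewrite /w point3E.
move=> k; rewrite lerD2l [w k 0 2]point3E.
have hw : height <= enorm (w k.+1).
  by apply: le_trans (le_trans (ler_norm _) (coord_le_enorm _ 2)); rewrite point3E.
rewrite ger0_norm; last by rewrite subr_ge0; exact: rad_inv_height.
rewrite lerD2r; apply: ler_rad_inv; first exact: lt_le_trans hw.
apply: le_trans (le_enorm_sum _) _; rewrite !point3E [`|height|]gtr0_norm//.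
have [b1 b2] := bs k.+1; rewrite !normrM ger0_norm//; lra.
Qed.

(** Above a point x of the hair every speed g occurs. The heights iter k rad g of
    the pseudo-orbit to be shadowed are those of an orbit of [rad]; from some time
    k0 on they exceed the heights of the orbit of x. So they dominate the indices
    s k, which are bounded by the norm of the orbit of x, and the points w k over
    the centres of the beams do form a pseudo-orbit with bounded errors. Before
    k0 any point of the beam will do. The true orbit found has the heights of w
    up to a bounded error, which the contraction of [rad_inv] wipes out. *)
Lemma speed_onto s x (g : R) : hair_of s x -> speed x < g ->
  exists2 y, hair_of s y & speed y = g.
Proof.
move=> hx sg; have [k0 k0g] := speed_approx sg.
have h0 := height_gt0; have h1 := height_gt1.
pose t k := iter k rad g.
have xt k : (k0 <= k)%N -> iter k f x 0 2 <= t k.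
  move=> kk; apply: iter_rad_inv_leP.
    exact: ltW (high_height (high_iter k hx.1)).
  exact: le_trans (level_decr hx.1 kk) (ltW k0g).
pose w k : 'rV[R]_3 := point3 (2 * (s k).1%:~R) (2 * (s k).2%:~R) (Num.max height (t k)).
pose D k : R := 4 + `|rad_inv (enorm (w k.+1)) - w k 0 2|.
have ht k : (k0 <= k)%N -> height <= t k.
  by move=> kk; apply: le_trans (xt k kk); exact: ltW (high_height (high_iter k hx.1)).
have wt k : (k0 <= k)%N -> w k 0 2 = t k.
  by move=> kk; rewrite point3E max_r// ht.
have D8 k : (k0 <= k)%N -> D k <= 8.
  move=> kk; have tk := ht k kk; have tk1 := ht k.+1 (leqW kk).
  have wk1 : t k.+1 <= enorm (w k.+1).
    by rewrite -(wt k.+1 (leqW kk)); exact: le_trans (ler_norm _) (coord_le_enorm _ _).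
  have lo : t k <= rad_inv (enorm (w k.+1)).
    by rewrite -[t k]radK; apply: ler_rad_inv; [exact: rad_gt0|].
  have hi : rad_inv (enorm (w k.+1)) <= t k + 4.
    rewrite -ler_rad rad_invK; last by apply: lt_le_trans wk1; exact: lt_le_trans tk1.
    apply: le_trans (rad_add (t k) 4).
    have rt : rad (t k) = t k.+1 by [].
    have xr : enorm (iter k.+1 f x) <= t k.+1.
      by rewrite iterS enorm_map -rt ler_rad xt.
    have c i (n : int) : `|iter k.+1 f x 0 i - 2 * n%:~R| <= 1 -> `|2 * n%:~R| <= t k.+1 + 1.
      move=> b; have := ler_normD (2 * n%:~R - iter k.+1 f x 0 i) (iter k.+1 f x 0 i).
      rewrite subrK distrC; have := coord_le_enorm (iter k.+1 f x) i; lra.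
    have [b0 b1] := hx.2 k.+1; have {b0}c0 := c _ _ b0; have {b1}c1 := c _ _ b1.
    apply: le_trans (le_enorm_sum _) _; rewrite rt (wt _ (leqW kk)) !point3E.
    rewrite [`|t k.+1|]ger0_norm; last by lra.
    have -> : (2 : R) ^+ 4 = 16 by ring.
    lra.
  rewrite /D (wt k kk) ger0_norm ?subr_ge0//; lra.
pose C : R := 8 + \sum_(j < k0) D j.
have D0 k : 0 <= D k by rewrite addr_ge0.
have DC k : D k <= C.
  have [kk|kk] := leqP k0 k.
    by apply: le_trans (D8 k kk) _; rewrite lerDl sumr_ge0.
  by rewrite /C (bigD1 (Ordinal kk))//= addrCA lerDl addr_ge0// sumr_ge0.
have [|||y hy yw] := @shadow s w C _ _ _ DC.
- by move=> k; exact: hair_sign hx.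
- by move=> k; exact: centre_beam.
- by move=> k; rewrite point3E le_max lexx.
exists y => //.
have c01 : 0 <= contr < 1 by case/andP: contr_lt1 => /ltW -> ->.
have near_g k : (k0 <= k)%N -> `|level k y - g| <= contr ^+ k * (C / (1 - contr)).
  move=> kk; have hyk : height <= iter k f y 0 2 by exact: ltW (high_height (high_iter k hy.1)).
  have := iter_rad_inv_lip k hyk (ht k kk); rewrite /t iter_radK => H.
  apply: le_trans H _; rewrite ler_wpM2l ?exprn_ge0//; first by case/andP: c01.
  apply: le_trans (yw k); apply: le_trans (coord_le_enorm _ 2).
  by rewrite !mxE; have := wt k kk; rewrite !mxE/= => ->.
apply/eqP; rewrite eq_le; apply/andP; split; apply/ler_addgt0Pr => e e0.
  have [K _ HK] := small_power (C / (1 - contr)) c01 e0.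
  have := near_g (K + k0)%N (leq_addl _ _); have := HK (K + k0)%N (leq_addr _ _).
  have := speed_le (K + k0) hy.1.
  rewrite ler_norml => a b /andP[_ c]; lra.
rewrite -lerBlDr; apply: speed_ge => j.
have [K _ HK] := small_power (C / (1 - contr)) c01 e0.
have := near_g (j + K + k0)%N (leq_addl _ _).
have := HK (j + K + k0)%N; rewrite -addnA addnCA leq_addr => /(_ isT).
have := level_decr hy.1 (leq_addr (K + k0) j).
rewrite addnCA ler_norml => a b /andP[c _]; lra.
Qed.

(** * Each hair is a curve *)

(** The condition that the orbit stays above L is not closed, but on the hair it
    is equivalent to staying above [height], which is. *)
Lemma hair_of_closed s : closed (hair_of s).
Proof.
move=> x clx.
have H k (e : R) : 0 < e -> exists2 y, hair_of s y & enorm (iter k f x - iter k f y) < e.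
  by move=> e0; have [y [hy xy]] := clx _ (@near_iter x k e e0); exists y.
have C k i (P : R -> Prop) :
    (forall t, (forall e : R, 0 < e -> exists2 t', P t' & `|t - t'| < e) -> P t) ->
    (forall y, hair_of s y -> P (iter k f y 0 i)) -> P (iter k f x 0 i).
  move=> clP Py; apply: clP => e e0; have [y hy xy] := H k e e0.
  exists (iter k f y 0 i); first exact: Py.
  by apply: le_lt_trans xy; apply: le_trans (coord_le_enorm _ i); rewrite !mxE.
split=> k.
  apply: lt_le_trans height_gtL _.
  apply: (C k 2 (fun t => height <= t)); first exact: ge_closed_approx.
  by move=> y hy; exact: ltW (high_height (high_iter k hy.1)).
split.
  apply: (C k 0 (fun t => `|t - 2 * (s k).1%:~R| <= 1)).
    exact: interval_closed_approx.
  by move=> y hy; case: (hy.2 k).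
apply: (C k 1 (fun t => `|t - 2 * (s k).2%:~R| <= 1)).
  exact: interval_closed_approx.
by move=> y hy; case: (hy.2 k).
Qed.

Lemma hair_of_beam s x : hair_of s x ->
  `|x 0 0| <= 2 * `|(s 0%N).1%:~R| + 1 /\ `|x 0 1| <= 2 * `|(s 0%N).2%:~R| + 1.
Proof.
move=> hx; have [/= b0 b1] := hx.2 0%N.
have := ler_normD (x 0 0 - 2 * (s 0%N).1%:~R) (2 * (s 0%N).1%:~R).
have := ler_normD (x 0 1 - 2 * (s 0%N).2%:~R) (2 * (s 0%N).2%:~R).
rewrite !subrK !normrM (ger0_norm (ler0n R 2)) => n1 n0; split; lra.
Qed.

Lemma hair_part_compact s (T : R) : compact (hair_of s `&` [set x | x 0 2 <= T]).
Proof.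
apply: bounded_closed_compact.
  exists (2 * `|(s 0%N).1%:~R| + 2 * `|(s 0%N).2%:~R| + 2 + `|T|); split; first exact: num_real.
  move=> M hM x [hx xT]; apply: le_trans (norm_le_enorm x) _.
  apply: le_trans (le_enorm_sum x) _.
  have [b0 b1] := hair_of_beam hx; rewrite [`|x 0 2|]gtr0_norm ?(high_pos hx.1)//.
  have := ler_norm T; move: xT => /= xT; lra.
apply: closedI; first exact: hair_of_closed.
have cl : closed ((fun x : 'rV[R]_3 => x 0 2) @^-1` [set t | t <= T]).
  by apply: closed_comp => [x _|]; [exact: coord_continuous|exact: closed_le].
exact: cl.
Qed.

(** Take points x_n of the hair whose speeds tend to the infimum. Eventually
    they are slower than a fixed point x0, hence less than 4 higher, so they stay
    in a compact part of the hair and have a limit point p. If the infimum were not attained, then some z would be slower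
    than p, hence slower than the x_n near p, although the speeds of the x_n
    eventually drop below that of z. *)
Lemma speed_min s : hair_of s !=set0 ->
  exists2 y, hair_of s y & forall x, hair_of s x -> speed y <= speed x.
Proof.
move=> [x0 hx0]; apply: contrapT => noMin.
have {noMin} below x : hair_of s x -> exists2 z, hair_of s z & speed z < speed x.
  move=> hx; apply: contrapT => nz; apply: noMin; exists x => // z hz.
  by rewrite leNgt; apply/negP => zx; apply: nz; exists z.
pose S := [set speed x | x in hair_of s].
have hS : has_inf S.
  split; first by exists (speed x0), x0.
  by exists height => _ [x hx <-]; exact: speed_height hx.1.
have xsP (n : nat) : exists x, hair_of s x /\ speed x < inf S + n.+1%:R^-1.
  have n0 : 0 < n.+1%:R^-1 :> R by rewrite invr_gt0.
  by have [_ [x hx <-] lt] := inf_adherent n0 hS; exists x.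
have [xs hxs] := choice xsP.
have evt z : hair_of s z -> \forall n \near \oo, speed (xs n) < speed z.
  move=> hz; have [z' hz' z'z] := below z hz.
  have Iz : inf S < speed z by apply: le_lt_trans z'z; apply: ge_inf; [case: hS|exists z'].
  have d0 : 0 < speed z - inf S by rewrite subr_gt0.
  apply: filterS (near_infty_natSinv_lt (PosNum d0)) => n /= Hn.
  by have [_ H2] := hxs n; apply: lt_trans H2 _; rewrite -ltrBrDl.
pose K := hair_of s `&` [set x | x 0 2 <= x0 0 2 + 4].
have FK : \forall n \near \oo, K (xs n).
  apply: filterS (evt x0 hx0) => n lt; split; first by case: (hxs n).
  rewrite /= leNgt; apply/negP => /ltW gap.
  have := gap_speed_lt (k := 0) (hxs n).1 hx0 gap; rewrite ltNge.
  by rewrite (ltW lt).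
have [p [[hp _] clp]] := @hair_part_compact s (x0 0 2 + 4) (xs @ \oo) _ FK.
have [z hz zp] := below p hp.
have N1 : (xs @ \oo) [set x | hair_of s x /\ speed x < speed z].
  by apply: filterS (evt z hz) => n lt; split=> //; case: (hxs n).
have [x [[hx xz] H]] := clp _ _ N1 (speed_gt_near hp hz zp).
by have := lt_trans xz (H hx); rewrite ltxx.
Qed.

(** Speed, counted from its minimum, is a continuous bijection from the hair onto
    [0, +oo[ whose inverse is continuous. *)
Lemma hair_of_hair s : hair_of s !=set0 -> hair (hair_of s).
Proof.
move=> ne; have [y0 hy0 miny] := speed_min ne.
have gP (t : R) : exists y, 0 <= t -> hair_of s y /\ speed y = speed y0 + t.
  have [t0|t0] := leP 0 t; last by exists y0.
  move: t0; rewrite le_eqVlt => /orP[/eqP <-|t0]; first by exists y0; rewrite addr0.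
  have lt : speed y0 < speed y0 + t by rewrite ltrDl.
  by have [y hy yE] := speed_onto hy0 lt; exists y.
have [gamma gammaP] := choice gP.
exists gamma; split.
- apply/subspace_continuousP => t /=; rewrite in_itv/= andbT => t0.
  have [ht tE] := gammaP t t0.
  apply/cvg_enormP => e e0; have [d d0 Hd] := speed_inv_cont ht e0.
  rewrite near_withinE.
  have N : \forall r \near t, `|t - r| < d by apply/nbhs_ballP; exists d.
  apply: filterS N => r tr; rewrite /= in_itv/= andbT => r0.
  have [hr rE] := gammaP r r0; apply: Hd => //.
  by rewrite tE rE opprD addrACA subrr add0r.
- apply/seteqP; split => [_ [t + <-]|x hx].
    by rewrite /= in_itv/= andbT => t0; case: (gammaP t t0).
  have t0 : 0 <= speed x - speed y0 by rewrite subr_ge0 miny.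
  exists (speed x - speed y0); first by rewrite /= in_itv/= andbT.
  have [hg gE] := gammaP _ t0; apply: speed_inj hg hx _.
  by rewrite gE addrC subrK.
- exists (fun x => speed x - speed y0); split; last first.
    by move=> t t0; have [_ ->] := gammaP t t0; rewrite addrC addKr.
  apply/subspace_continuousP => x hx.
  apply: cvgB; last exact: cvg_cst.
  apply/cvgrPdist_lt => e e0; rewrite near_withinE.
  have up : \forall z \near x, hair_of s z -> speed z < speed x + e.
    by apply: speed_lt_near => //; rewrite ltrDl.
  have lo : \forall z \near x, hair_of s z -> speed x - e < speed z.
    have [min|lt] := leP (speed x) (speed y0).
      near=> z => hz; apply: lt_le_trans (miny z hz).
      by rewrite ltrBlDr; apply: le_lt_trans min _; rewrite ltrDl.
    have [w hw wE] : exists2 w, hair_of s w & speed w = Num.max (speed y0) (speed x - e).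
      have [le|lt'] := leP (speed x - e) (speed y0); first by exists y0.
      exact: speed_onto hy0 lt'.
    have wx : speed w < speed x by rewrite wE gt_max lt ltrBlDr ltrDl.
    apply: filterS (speed_gt_near hx hw wx) => z Hz hz.
    by apply: le_lt_trans (Hz hz); rewrite wE le_max lexx orbT.
  apply: filterS2 up lo => z Hup Hlo hz.
  by rewrite ltr_norml; have := Hup hz; have := Hlo hz; move=> *; apply/andP; split; lra.
- apply/cvgryPge => A; near=> t.
  have t0 : 0 <= t by near: t; apply: nbhs_pinfty_ge; exact: num_real.
  have [ht tE] := gammaP t t0.
  apply: le_trans (_ : t <= _); first by near: t; apply: nbhs_pinfty_ge; exact: num_real.
  apply: le_trans (le_trans (ler_norm _) (coord_le_enorm _ 2)).
  apply: le_trans (speed_le 0 ht.1); rewrite tE lerDr.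
  exact: le_trans (ltW height_gt0) (speed_height hy0.1).
Unshelve. all: by end_near. Qed.

(** A hair lies in one beam, so it can only escape through its third coordinate. *)
Lemma hair_of_parametrization s (gamma : R -> 'rV[R]_3) :
  hair_parametrization (hair_of s) gamma ->
  gamma t 0 2 @[t --> +oo] --> +oo /\
  exists M : R, forall t, 0 <= t -> `|gamma t 0 0| <= M /\ `|gamma t 0 1| <= M.
Proof.
move=> [_ gH _ ginf].
have gs t : 0 <= t -> hair_of s (gamma t).
  by move=> t0; rewrite -gH; exists t => //=; rewrite in_itv/= andbT.
pose M : R := 2 * `|(s 0%N).1%:~R| + 2 * `|(s 0%N).2%:~R| + 1.
have gM t : 0 <= t -> `|gamma t 0 0| <= M /\ `|gamma t 0 1| <= M.
  move=> t0; have [b0 b1] := hair_of_beam (gs t t0).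
  have := normr_ge0 ((s 0%N).1%:~R : R); have := normr_ge0 ((s 0%N).2%:~R : R).
  by rewrite /M; split; lra.
split; last by exists M.
apply/cvgryPge => A; near=> t.
have t0 : 0 <= t by near: t; apply: nbhs_pinfty_ge; exact: num_real.
have far : A + 2 * M <= enorm (gamma t) by near: t; move/cvgryPge: ginf; exact.
have [b0 b1] := gM t t0; have := le_enorm_sum (gamma t).
rewrite [`|gamma t 0 2|]gtr0_norm; last exact: high_pos (gs t t0).1.
lra.
Unshelve. all: by end_near. Qed.

(** * There are uncountably many hairs *)

Definition binary_itinerary (b : nat -> bool) (k : nat) : int * int :=
  if b k then (1, 1) else (0, 0).

Lemma binary_hair b : hair_of (binary_itinerary b) !=set0.
Proof.
apply: hair_of_bounded => k; rewrite /binary_itinerary; case: (b k) => /=.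
- by rewrite -[(1 + 1)%R]/(Posz 2) -exprnP sqrrN expr1n.
- by rewrite addr0 expr0z.
- by rewrite normr1.
- by rewrite normr0.
Qed.

Lemma binary_hair_inj b c :
  hair_of (binary_itinerary b) = hair_of (binary_itinerary c) -> b = c.
Proof.
move=> E; have [x hx] := binary_hair b; have hx' := hx; rewrite E in hx'.
have /(congr1 (fun s => s _)) sE := hair_of_inj hx hx'.
apply/funext => k; move: (sE k); rewrite /binary_itinerary.
by case: (b k); case: (c k).
Qed.

Definition hairs : set (set 'rV[R]_3) :=
  [set H | exists s, H = hair_of s /\ hair_of s !=set0].

(** Cantor's diagonal argument on the hairs with binary itineraries. *)
Lemma hairs_uncountable : ~ countable hairs.
Proof.
move=> /countable_injP [e einj].
have inH b : hair_of (binary_itinerary b) \in hairs.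
  by rewrite inE; exists (binary_itinerary b); split=> //; exact: binary_hair.
pose code b := e (hair_of (binary_itinerary b)).
have code_inj b c : code b = code c -> b = c.
  by move=> E; apply: binary_hair_inj; apply: einj.
pose d (n : nat) := `[< forall b, code b = n -> b n = false >].
have dE : d (code d) = ~~ d (code d).
  apply/idP/idP => [/asboolP dd|nd]; first by rewrite (dd d).
  by apply/asboolP => b /code_inj ->; exact: negbTE.
by move: dE; case: (d _).
Qed.

(** * The dynamics of the scaled Zorich map *)

Lemma zorich_dynamics :
  (exists hairs : set (set 'rV[R]_3),
     [/\ ~ countable hairs,
         (forall H H', hairs H -> hairs H' -> H <> H' -> H `&` H' = set0),
         julia f = \bigcup_(H in hairs) H &
         forall H, hairs H ->
           hair H /\
           forall gamma : R -> 'rV[R]_3, hair_parametrization H gamma ->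
             gamma t 0 2 @[t --> +oo] --> +oo /\
             exists M : R, forall t, 0 <= t ->
               `|gamma t 0 0| <= M /\ `|gamma t 0 1| <= M]) /\
  (forall x, ~ julia f x ->
     exists p, f p = p /\ iter k f x @[k --> \oo] --> p).
Proof.
split; last by move=> x; rewrite juliaE => nx; exact: not_high_converges.
exists hairs; split.
- exact: hairs_uncountable.
- move=> _ _ [s [-> _]] [s' [-> _]] ne; apply/seteqP; split=> // x [hx hx'].
  by case: ne; rewrite (hair_of_inj hx hx').
- rewrite juliaE; apply/seteqP; split=> [x hx|x [_ [s [-> _]] [//]]].
  have [s hs] := high_hair hx.
  by exists (hair_of s) => //; exists s; split=> //; exists x.
- move=> _ [s [-> ne]]; split; first exact: hair_of_hair.
  by move=> gamma; exact: hair_of_parametrization.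
Qed.

End ZorichDynamics.

Unset Implicit Arguments.

Theorem lemma2 (R : realType) (L : R) (h : 'rV[R]_2 -> 'rV[R]_3)
    (Z : 'rV[R]_3 -> 'rV[R]_3)
    (hLip : bilipschitz_on (@square R) L h)
    (honto : h @` @square R = @upper_hemisphere R)
    (hsense : sense_preserving h)
    (hZ : zorich_map h Z)
    (lambda : R) (hlambda : 0 < lambda < expR (- (ln L + L))) :
  let f := fun x : 'rV[R]_3 => lambda *: Z x in
  (exists hairs : set (set 'rV[R]_3),
     [/\ ~ countable hairs,
         (forall H H', hairs H -> hairs H' -> H <> H' -> H `&` H' = set0),
         julia f = \bigcup_(H in hairs) H &
         forall H, hairs H ->
           hair H /\
           forall gamma : R -> 'rV[R]_3, hair_parametrization H gamma ->
             gamma t 0 2 @[t --> +oo] --> +oo /\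
             exists M : R, forall t, 0 <= t ->
               `|gamma t 0 0| <= M /\ `|gamma t 0 1| <= M]) /\
  (forall x, ~ julia f x ->
     exists p, f p = p /\ iter k f x @[k --> \oo] --> p).
Proof. exact: (zorich_dynamics hLip honto hZ hlambda). Qed.
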